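(* Let $d>1$, let $\{f_n\}_{n\ge 1}$ be a $d$-decaying Gauss like iterated function system on $[0,1]$, and let $\{a_n(x)\}_{n\ge1}$ denote the digits of $x$ in this system. Let $m\ge1$ be an integer and let $t_0,\dots,t_m$ be non-negative real numbers with $t_0\ne0$ and $t_i\neq 0$ for at least one $1\le i\le m$. For $x\in(0,1)$ put $$\tau_2(x):=\inf\Big\{s\ge 0:\ \sum_{n\ge 1}\big(a_n(x)^{t_0}a_{n+1}(x)^{t_1}\cdots a_{n+m}(x)^{t_m}\big)^{-s}<\infty\Big\}\in[0,\infty].$$ Then for every $0\le\alpha<\infty$ the set $$E(\alpha,\{t_i\}_{0\le i\le m}):=\{x\in(0,1):\ \tau_2(x)=\alpha\}$$ satisfies $$\dim_{\rm H}E(\alpha,\{t_i\}_{0\le i\le m})=\frac1d,$$ where $\dim_{\rm H}$ denotes Hausdorff dimension.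
   Context: $\mathbb{N}=\{1,2,3,\dots\}$. Let $d>1$. A sequence $\{f_n\}_{n\ge1}$ of $C^1$ functions $f_n:[0,1]\to[0,1]$ is a $d$-decaying Gauss like iterated function system if: (i) (open set condition) $f_i((0,1))\cap f_j((0,1))=\emptyset$ for all $i\ne j$ in $\mathbb{N}$; (ii) (contraction) there exist $q\in\mathbb{N}$ and $0<\rho<1$ such that $0<|(f_{a_1}\circ\cdots\circ f_{a_q})'(x)|\le\rho<1$ for all $(a_1,\dots,a_q)\in\mathbb{N}^q$ and $x\in[0,1]$; (iii) (regularity) for every $\varepsilon>0$ there are constants $C_1=C_1(\varepsilon)>0$, $C_2=C_2(\varepsilon)>0$ such that for each $i\in\mathbb{N}$ there are constants $\xi_i,\lambda_i$ with $\xi_i\le|f_i'(x)|\le\lambda_i$ for all $x\in[0,1]$ and $\frac{C_1}{i^{d+\varepsilon}}\le\xi_i\le\lambda_i\le\frac{C_2}{i^{d-\varepsilon}}$; (iv) $\bigcup_{i=1}^\infty f_i([0,1])=(0,1]$, and $f_i(x)<f_j(x)$ whenever $i>j$; (v) (bounded distortion) there is $\kappa\ge1$ such that for every $n\in\mathbb{N}$ and $(a_1,\dots,a_n)\in\mathbb{N}^n$, $|(f_{a_1}\circ\cdots\circ f_{a_n})'(x)|\le\kappa\,|(f_{a_1}\circ\cdots\circ f_{a_n})'(y)|$ for all $x,y\in[0,1]$. Digits: for $\underline a=\{a_n\}_{n\ge1}\in\mathbb{N}^{\mathbb{N}}$ put $\Pi(\underline a)=\lim_{n\to\infty}f_{a_1}\circ\cdots\circ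 f_{a_n}(1)$. For all but countably many $x\in(0,1)$ there is exactly one $\underline a\in\mathbb{N}^{\mathbb{N}}$ with $\Pi(\underline a)=x$; its entries are the digits of $x$, written $a_n(x)$. Sets defined by digits are understood to consist of such points $x$ only (countable sets do not affect Hausdorff dimension). Convention: $\inf\emptyset=\infty$. *)

(* Defs.v *)
From mathcomp Require Import all_boot all_order all_algebra.
From mathcomp Require Import all_classical all_reals all_analysis.
Set Implicit Arguments.
Unset Strict Implicit.
Unset Printing Implicit Defensive.
Import Order.TTheory GRing.Theory Num.Theory.
Import numFieldNormedType.Exports.
Local Open Scope classical_set_scope.
Local Open Scope ring_scope.

(* Only the values of a function R -> R on [0, 1] matter below: difference
   quotients are taken within [0, 1], so the derivatives at 0 and 1 are
   one-sided. *)
Definition diff_quot01 {R : realType} (g : R -> R) (x : R) : set_system R :=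
  (g y - g x) / (y - x) @[y --> within `[0, 1]%classic x^'].

Definition deriv01 {R : realType} (g : R -> R) (x : R) : R :=
  lim (diff_quot01 g x).

Definition C1_on01 {R : realType} (g : R -> R) : Prop :=
  (forall x, 0 <= x <= 1 -> cvg (diff_quot01 g x)) /\
  {within `[0, 1], continuous (deriv01 g)}.

Definition word_map {R : realType} (f : nat -> R -> R) (w : seq nat) : R -> R :=
  foldr (fun i g => f i \o g) id w.

(* Words and digits take positive values; the map [f 0] plays no role. *)
Record gauss_like_ifs {R : realType} (d : R) (f : nat -> R -> R) : Prop := {
  gl_C1 : forall i, (0 < i)%N -> C1_on01 (f i);
  gl_stable : forall i, (0 < i)%N ->
    forall x, 0 <= x <= 1 -> 0 <= f i x <= 1;
  gl_open_set : forall i j, (0 < i)%N -> (0 < j)%N -> i <> j ->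
    f i @` `]0, 1[%classic `&` f j @` `]0, 1[%classic = set0;
  gl_contraction : exists (q : nat) (rho : R), [/\ (0 < q)%N, 0 < rho < 1 &
    forall w : seq nat, size w = q -> all (leq 1) w ->
    forall x, 0 <= x <= 1 -> 0 < `|deriv01 (word_map f w) x| <= rho];
  gl_regularity : forall eps : R, 0 < eps -> exists C1 C2 : R,
    [/\ 0 < C1, 0 < C2 &
    forall i : nat, (0 < i)%N -> exists xi lambda : R,
      (forall x, 0 <= x <= 1 -> xi <= `|deriv01 (f i) x| <= lambda) /\
      [/\ C1 / i%:R `^ (d + eps) <= xi, xi <= lambda &
          lambda <= C2 / i%:R `^ (d - eps)]];
  gl_cover :
    \bigcup_(i in [set i | (0 < i)%N]) (f i @` `[0, 1]%classic) =
    `]0, 1]%classic;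
  gl_order : forall i j, (0 < j)%N -> (j < i)%N ->
    forall x, 0 <= x <= 1 -> f i x < f j x;
  gl_distortion : exists kappa : R, 1 <= kappa /\
    forall n : nat, (0 < n)%N ->
    forall w : seq nat, size w = n -> all (leq 1) w ->
    forall x y, 0 <= x <= 1 -> 0 <= y <= 1 ->
      `|deriv01 (word_map f w) x| <= kappa * `|deriv01 (word_map f w) y|
}.

(* Positions in digit sequences start at 0: [a n] stands for a_{n+1}.
   [codes f x a] says that a is a sequence of positive integers with
   Pi(a) = x. *)
Definition codes {R : realType} (f : nat -> R -> R) (x : R) (a : nat -> nat)
    : Prop :=
  (forall n, (0 < a n)%N) /\
  word_map f (mkseq a n) 1 @[n --> \oo] --> x.

Definition digits {R : realType} (f : nat -> R -> R) (x : R) (a : nat -> nat)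
    : Prop :=
  unique (codes f x) a.

Definition tau2 {R : realType} (m : nat) (t : 'I_m.+1 -> R) (a : nat -> nat)
    : \bar R :=
  ereal_inf [set s%:E | s in [set s : R | 0 <= s /\
    (\sum_(0 <= n <oo)
       ((\prod_(i < m.+1) (a (n + i)%N)%:R `^ t i) `^ (- s))%:E < +oo)%E]].

Definition tau2_level {R : realType} (f : nat -> R -> R) (m : nat)
    (t : 'I_m.+1 -> R) (alpha : R) : set R :=
  [set x | 0 < x < 1 /\ exists a, digits f x a /\ tau2 t a = alpha%:E].

(* The diameter of the empty set is -oo here. *)
Definition diam {R : realType} (U : set R) : \bar R :=
  ereal_sup [set `|p.1 - p.2|%:E | p in U `*` U].

(* diam(U)^s, where the empty set counts for 0 even when s = 0, while a
   nonempty set counts for 1 when s = 0. *)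
Definition diam_pow {R : realType} (s : R) (U : set R) : \bar R :=
  if U == set0 then 0%E else poweR (diam U) s.

Definition hausdorff_premeasure {R : realType} (s delta : R) (A : set R)
    : \bar R :=
  ereal_inf [set (\sum_(0 <= k <oo) diam_pow s (U k))%E | U in
    [set U : nat -> set R | A `<=` \bigcup_k U k /\
                            forall k, (diam (U k) <= delta%:E)%E]].

Definition hausdorff_measure {R : realType} (s : R) (A : set R) : \bar R :=
  ereal_sup [set hausdorff_premeasure s delta A |
             delta in [set delta : R | 0 < delta]].

Definition hausdorff_dim {R : realType} (A : set R) : \bar R :=
  ereal_inf [set s%:E | s in
    [set s : R | 0 <= s /\ hausdorff_measure s A = 0%E]].

(* Main.v *)
Require Import Defs.
From mathcomp Require Import all_boot all_order all_algebra.
From mathcomp Require Import all_classical all_reals all_analysis.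
From mathcomp Require Import ring lra zify.
Set Implicit Arguments.
Unset Strict Implicit.
Unset Printing Implicit Defensive.
Import Order.TTheory GRing.Theory Num.Theory.
Import numFieldNormedType.Exports.
Local Open Scope classical_set_scope.
Local Open Scope ring_scope.

(** Coding [x] by its digits, [f_(a 0)] maps the point of the shifted sequence to [x].

    Upper bound. If [tau2] is finite, the products tend to infinity, so for each [M]
    every late enough window of [m+1] consecutive digits contains a digit above [M].
    Let [G] be the set of points all of whose windows do. Splitting off the digits up to
    the first one above [M] covers [G] by images of [G] under Lipschitz maps whose
    constants, raised to the power [s > 1/d], have a sum that tends to [0] as [M] grows.
    Once this sum is at most [1/2], a cover of [G] of cost [c] gives one of cost [c/2].

    Lower bound. Take [l n = (n+1)^(1/(alpha T))], [T] the sum of the [t i] (and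
    [l n = 2^n] if [alpha = 0]); digits with [l n <= a n <= 4 l n] give
    [tau2 = alpha]. Writing [u] in [[0, 1)] in the mixed radix [L n ~ l n] and sending it
    to the point with digits [L n + (n-th radix digit of u)] defines a map [Psi] with
    [|u - v| <= C |Psi u - Psi v|^s] for [s < 1/d]; a cover of its image of small cost
    would therefore give a cover of [[0, 1)] by intervals of total length below [1]. *)

(** * Derivatives within the unit interval *)

Section Derivative01.
Context {R : realType}.
Implicit Types (g : R -> R) (x y l : R).

(** Multiplying the limit out by [y - x] gives a linear approximation that also holds at [y = x],
    where the punctured filter says nothing. *)
Lemma diff_quot01_approx g x l : diff_quot01 g x --> l ->
  forall e, 0 < e -> exists2 r, 0 < r & forall y, 0 <= y <= 1 -> `|y - x| < r ->
    `|g y - g x - l * (y - x)| <= e * `|y - x|.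
Proof.
move=> /cvgrPdist_lt gl e e0; have := gl _ e0.
rewrite /nbhs /= /within /= => /nbhs_ballP[r /= r0 gr]; exists r => // y y01 yr.
have [->|yx] := eqVneq y x; first by rewrite !subrr mulr0 subr0 normr0 mulr0.
have /(gr y) : ball x r y by rewrite -ball_normE /= distrC.
move/(_ yx); rewrite in_itv /= => /(_ y01) /ltW.
have yx0 : y - x != 0 by rewrite subr_eq0.
rewrite -(ler_pM2r (_ : 0 < `|y - x|)) ?normr_gt0 // -normrM mulrBl divfK //.
by rewrite distrC.
Qed.

Lemma diff_quot01_continuous g : (forall x, 0 <= x <= 1 -> cvg (diff_quot01 g x)) ->
  {within `[0, 1], continuous g}.
Proof.
move=> gc; apply/continuous_within_itvP; rewrite ?ltr01 //.
have gapp x : 0 <= x <= 1 -> forall e, 0 < e -> exists2 r, 0 < r &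
    forall y, 0 <= y <= 1 -> `|x - y| < r -> `|g x - g y| < e.
  move=> x01 e e0; set l := lim (diff_quot01 g x).
  have [r r0 gr] := diff_quot01_approx (gc _ x01) ltr01.
  (* Within [r] the increment of [g] is at most [(|l| + 1) * |y - x|], so this radius keeps it below
     [e]. *)
  exists (Num.min r (e / (`|l| + 2))).
    by rewrite lt_min r0 divr_gt0 // ltr_wpDl.
  move=> y y01; rewrite lt_min => /andP[yr ye].
  have := gr _ y01; rewrite distrC => /(_ yr) gy.
  have l2 : 0 < `|l| + 2 by rewrite ltr_wpDl.
  have : `|g y - g x| <= `|g y - g x - l * (y - x)| + `|l * (y - x)|.
    by rewrite -{1}(subrK (l * (y - x)) (g y - g x)) ler_normD.
  move: ye; rewrite ltr_pdivlMr // normrM (distrC (g x)).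
  move: gy; rewrite mul1r (distrC x y) -/l => gy ye gyx.
  have := normr_ge0 (y - x); have := normr_ge0 l; nra.
split.
- move=> x /[!in_itv]/= /andP[x0 x1].
  apply/cvgrPdist_lt => e e0.
  have [r r0 gr] := gapp x (introT andP (conj (ltW x0) (ltW x1))) _ e0.
  near=> y; apply: gr.
    by apply/andP; split; apply: ltW; near: y; [exact: lt_nbhsr|exact: lt_nbhsl].
  near: y; apply/nbhs_ballP; exists r => // y; rewrite -ball_normE.
- apply/cvgrPdist_lt => e e0.
  have [|r r0 gr] := gapp 0 _ _ e0; first by rewrite lexx ler01.
  near=> y; apply: gr.
    by apply/andP; split; near: y; [exact: nbhs_right_ge|exact: nbhs_right_le].
  near: y; apply: cvg_within; apply/nbhs_ballP; exists r => // y; rewrite -ball_normE.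
- apply/cvgrPdist_lt => e e0.
  have [|r r0 gr] := gapp 1 _ _ e0; first by rewrite lexx ler01.
  near=> y; apply: gr.
    by apply/andP; split; near: y; [exact: nbhs_left_ge|exact: nbhs_left_le].
  near: y; apply: cvg_within; apply/nbhs_ballP; exists r => // y; rewrite -ball_normE.
Unshelve. all: by end_near.
Qed.

(** Small increments from an interior point stay in the unit interval, so the restricted quotient is
    the ordinary one there. This gives access to the usual mean value theorem. *)
Lemma diff_quot01_is_derive g x : 0 < x < 1 -> cvg (diff_quot01 g x) ->
  is_derive x 1 g (deriv01 g x).
Proof.
move=> /andP[x0 x1] gc.
suff gd : h^-1 *: ((g \o shift x) (h *: 1) - g x) @[h --> 0^'] --> deriv01 g x.
  by split; [apply/cvg_ex; exists (deriv01 g x)|exact: cvg_lim gd].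
apply/cvgrPdist_le => e e0.
have [r r0 gr] := diff_quot01_approx gc e0.
near=> h.
have h0 : h != 0 by near: h; exact: nbhs_dnbhs_neq.
rewrite /= /GRing.scale /= mulr1.
have := gr (h + x); rewrite addrK -/(deriv01 g x) => hr.
have hd : `|h| < Num.min r (Num.min x (1 - x)).
  near: h; apply: dnbhs0_lt; by rewrite !lt_min r0 x0 subr_gt0.
move: hd; rewrite !lt_min => /and3P[hr' hx h1].
rewrite -(ler_pM2r (_ : 0 < `|h|)) ?normr_gt0 // -normrM mulrBl distrC.
rewrite -mulrA (mulrC _ h) mulKf //; apply: hr => //.
move: hx h1; rewrite !ltr_norml; lra.
Unshelve. all: by end_near.
Qed.

(** The intermediate point is only located in the closed unit interval: this suffices for uniform
    derivative bounds and allows [x] and [y] in any order, or equal. *)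
Lemma deriv01_MVT g : (forall x, 0 <= x <= 1 -> cvg (diff_quot01 g x)) ->
  forall x y, 0 <= x <= 1 -> 0 <= y <= 1 -> exists2 c, 0 <= c <= 1 &
    g y - g x = deriv01 g c * (y - x).
Proof.
move=> gc.
have lt_case x y : 0 <= x <= 1 -> 0 <= y <= 1 -> x < y -> exists2 c, 0 <= c <= 1 &
    g y - g x = deriv01 g c * (y - x).
  move=> /andP[x0 x1] /andP[y0 y1] xy.
  have [z /[!in_itv]/= /andP[z0 z1]||c /[!in_itv]/= /andP[c0 c1] E] := @MVT R g (deriv01 g) x y xy.
  - apply: diff_quot01_is_derive; first lra.
    apply: gc; lra.
  - apply: continuous_subspaceW (diff_quot01_continuous gc) => z /=.
    rewrite !in_itv /=; lra.
  - exists c => //; lra.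
move=> x y x01 y01; have [xy|yx|->] := ltgtP x y; first exact: lt_case.
  have [c c01 E] := lt_case _ _ y01 x01 yx.
  by exists c => //; rewrite -opprB E -mulrN opprB.
by exists y => //; rewrite !subrr mulr0.
Qed.

(* [lim] of a divergent filter is [point], which is [0] in [R]. *)
Lemma deriv01_neq0_cvg g x : deriv01 g x != 0 -> cvg (diff_quot01 g x).
Proof. exact: cvg_inNpoint. Qed.

End Derivative01.

(** * Coding of points by digits *)

Definition shift_code (a : nat -> nat) : nat -> nat := fun n => a n.+1.

Definition code_point {R : realType} (f : nat -> R -> R) (a : nat -> nat) : R :=
  lim (word_map f (mkseq a n) 1 @[n --> \oo]).

Definition positive_code (a : nat -> nat) := forall n, (0 < a n)%N.

Lemma mkseqS_shift (a : nat -> nat) n : mkseq a n.+1 = a 0 :: mkseq (shift_code a) n.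
Proof. by rewrite /mkseq /= (iotaDl 1) -map_comp. Qed.

Lemma all_mkseq_positive (a : nat -> nat) n : positive_code a -> all (leq 1) (mkseq a n).
Proof. by move=> a0; rewrite all_map; apply/allP => k _ /=; exact: a0. Qed.

Lemma positive_shift (a : nat -> nat) : positive_code a -> positive_code (shift_code a).
Proof. by move=> a0 n; exact: a0. Qed.

Section GaussLike.
Context {R : realType} {d : R} {f : nat -> R -> R}.
Hypothesis hf : gauss_like_ifs d f.
Implicit Types (x y c l : R) (a b : nat -> nat) (i j n : nat) (w : seq nat).

Let zero01 : 0 <= (0:R) <= 1. Proof. by rewrite lexx ler01. Qed.
Let one01 : 0 <= (1:R) <= 1. Proof. by rewrite lexx ler01. Qed.

Lemma word_map_cat w1 w2 x :
  word_map f (w1 ++ w2) x = word_map f w1 (word_map f w2 x).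
Proof. by elim: w1 => //= i w1 IH; rewrite /= -IH. Qed.

Lemma ifs_diff i : (0 < i)%N -> forall x, 0 <= x <= 1 -> cvg (diff_quot01 (f i) x).
Proof. by move=> i0; have [] := gl_C1 hf i0. Qed.

Lemma ifs_continuous i : (0 < i)%N -> {within `[0, 1], continuous (f i)}.
Proof. by move=> i0; apply: diff_quot01_continuous; exact: ifs_diff. Qed.

Definition expands c i := forall x y, 0 <= x <= 1 -> 0 <= y <= 1 ->
  c * `|x - y| <= `|f i x - f i y|.

(** The mean value theorem turns the derivative bounds of the regularity condition into two-sided
    bounds on increments, the form in which they are used from here on. *)
Lemma ifs_bilipschitz e : 0 < e -> exists C1 C2 : R, [/\ 0 < C1, 0 < C2 &
  forall i, (0 < i)%N -> expands (C1 * i%:R `^ (- (d + e))) i /\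
    forall x y, 0 <= x <= 1 -> 0 <= y <= 1 ->
      `|f i x - f i y| <= (C2 * i%:R `^ (- (d - e))) * `|x - y| ].
Proof.
move=> e0; have [C1 [C2 [C10 C20 reg]]] := gl_regularity hf e0.
exists C1, C2; split => // i i0.
have [xi [lam [bnd [lo _ hi]]]] := reg _ i0.
rewrite !powRN; split=> x y x01 y01.
  have [z z01 ->] := deriv01_MVT (ifs_diff i0) y01 x01.
  by rewrite normrM ler_wpM2r // (le_trans lo) //; case/andP: (bnd _ z01).
have [z z01 ->] := deriv01_MVT (ifs_diff i0) y01 x01.
by rewrite normrM ler_wpM2r // (le_trans _ hi) //; case/andP: (bnd _ z01).
Qed.

Lemma expands_pos i : (0 < i)%N -> exists2 c, 0 < c & expands c i.
Proof.
move=> i0; have [C1 [C2 [C10 _ /(_ _ i0)[ex _]]]] := ifs_bilipschitz ltr01.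
by exists (C1 * i%:R `^ (- (d + 1))) => //; rewrite mulr_gt0 // powR_gt0 // ltr0n.
Qed.

Lemma ifs_lipschitz i : (0 < i)%N -> exists2 l, 0 < l &
  forall x y, 0 <= x <= 1 -> 0 <= y <= 1 -> `|f i x - f i y| <= l * `|x - y|.
Proof.
move=> i0; have [C1 [C2 [_ C20 /(_ _ i0)[_ lip]]]] := ifs_bilipschitz ltr01.
by exists (C2 * i%:R `^ (- (d - 1))) => //; rewrite mulr_gt0 // powR_gt0 // ltr0n.
Qed.

Lemma ifs_inj i x y : (0 < i)%N -> 0 <= x <= 1 -> 0 <= y <= 1 -> f i x = f i y -> x = y.
Proof.
move=> i0 x01 y01 E; have [c c0 /(_ _ _ x01 y01)] := expands_pos i0.
rewrite E subrr normr0 pmulr_rle0 // normr_le0 subr_eq0; exact/eqP.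
Qed.

Lemma word_map01 w x : all (leq 1) w -> 0 <= x <= 1 -> 0 <= word_map f w x <= 1.
Proof.
elim: w => //= i w IH /andP[i0 w0] x01; apply: (gl_stable hf) => //; exact: IH.
Qed.

(** The word is cut into blocks of length [q]; each block contracts by [rho]. *)
Lemma word_contraction : exists q (rho : R), [/\ (0 < q)%N, 0 < rho < 1 &
  forall k w x y, size w = (k * q)%N -> all (leq 1) w ->
    0 <= x <= 1 -> 0 <= y <= 1 ->
    `|word_map f w x - word_map f w y| <= rho ^+ k].
Proof.
have [q [rho [q0 /andP[rho0 rho1] con]]] := gl_contraction hf.
exists q, rho; split; rewrite ?rho0 //.
elim=> [|k IH] w x y.
  move=> /size0nil -> _ /= /andP[x0 x1] /andP[y0 y1].
  by rewrite expr0 ler_norml; apply/andP; split; lra.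
rewrite mulSn => sw wpos x01 y01.
have wE : w = take q w ++ drop q w by rewrite cat_take_drop.
move: wpos; rewrite wE all_cat => /andP[tpos dpos].
rewrite !word_map_cat.
have st : size (take q w) = q by rewrite size_takel // sw leq_addr.
have sd : size (drop q w) = (k * q)%N by rewrite size_drop sw addKn.
(* Differentiability of the composed map is read off from its nonzero derivative, without a chain
   rule. *)
have wc z : 0 <= z <= 1 -> cvg (diff_quot01 (word_map f (take q w)) z).
  move=> z01; apply: deriv01_neq0_cvg.
  by have /andP[] := con _ st tpos _ z01; rewrite normr_gt0.
have [z z01 ->] := deriv01_MVT wc (word_map01 dpos y01) (word_map01 dpos x01).
have /andP[_ zr] := con _ st tpos _ z01.
by rewrite normrM exprS ler_pM // IH.
Qed.

Lemma code_cvg a : positive_code a ->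
  word_map f (mkseq a n) 1 @[n --> \oo] --> code_point f a.
Proof.
move=> a0; rewrite /code_point; apply/cauchy_cvgP/cauchy_exP => e e0.
have [q [rho [q0 /andP[rho0 rho1] con]]] := word_contraction.
have /cvgrPdist_lt/(_ _ e0)[k _ /(_ _ (leqnn k))] : rho ^+ n @[n --> \oo] --> (0:R).
  by apply: cvg_expr; rewrite gtr0_norm.
rewrite /= sub0r normrN ger0_norm ?exprn_ge0 ?ltW // => ke.
(* All longer words share the prefix of length [k * q], so their values lie within [rho ^+ k] of
   this one. *)
exists (word_map f (mkseq a (k * q)) 1); exists (k * q)%N => // n /= kn.
rewrite -ball_normE /=; apply: le_lt_trans ke.
have -> : mkseq a n = mkseq a (k * q) ++ map a (iota (k * q) (n - k * q)).
  by rewrite /mkseq -map_cat -(iotaD 0) subnKC.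
have ipos : all (leq 1) (map a (iota (k * q) (n - k * q))).
  by rewrite all_map; apply/allP => ? _ /=; exact: a0.
rewrite word_map_cat; apply: con => //; first by rewrite size_mkseq.
  exact: all_mkseq_positive.
exact: word_map01.
Qed.

Lemma code_point01 a : positive_code a -> 0 <= code_point f a <= 1.
Proof.
move=> a0; have wa n : 0 <= word_map f (mkseq a n) 1 <= 1.
  by apply: word_map01; rewrite ?one01 //; exact: all_mkseq_positive.
have ac := cvgP _ (code_cvg a0).
apply/andP; split.
  by apply: limr_ge => //; near=> n; have /andP[] := wa n.
by apply: limr_le => //; near=> n; have /andP[] := wa n.
Unshelve. all: by end_near.
Qed.

(** The first map is Lipschitz, so it can be taken out of the limit. *)
Lemma code_pointS a : positive_code a ->
  code_point f a = f (a 0) (code_point f (shift_code a)).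
Proof.
move=> a0; have sa0 := positive_shift a0.
have lhs : word_map f (mkseq a n.+1) 1 @[n --> \oo] --> code_point f a.
  by rewrite (@cvg_shiftS _ (fun n => word_map f (mkseq a n) 1)); exact: code_cvg.
apply: (@cvg_unique _ (@Rhausdorff R) _ _ _ _ lhs) => //.
have [l l0 lip] := ifs_lipschitz (a0 0).
apply/cvgrPdist_lt => e e0.
have /cvgrPdist_lt/(_ (e / l)) := code_cvg sa0.
rewrite divr_gt0 // => /(_ isT); apply: filterS => n.
rewrite ltr_pdivlMr // mulrC; apply: le_lt_trans.
rewrite mkseqS_shift /=; apply: lip; first exact: code_point01.
by apply: word_map01; rewrite ?one01 //; exact: all_mkseq_positive.
Qed.

(** The images of the unit interval cover exactly []0, 1]], so none of them contains 0. *)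
Lemma code_point_gt0 a : positive_code a -> 0 < code_point f a.
Proof.
move=> a0; have : (`]0, 1]%classic : set R) (code_point f a).
  rewrite -(gl_cover hf); exists (a 0); first exact: a0.
  exists (code_point f (shift_code a)); last by rewrite -code_pointS.
  rewrite /= in_itv /=; apply: code_point01; exact: positive_shift.
by rewrite /= in_itv /= => /andP[].
Qed.

Lemma codes_code_point x a : codes f x a <-> positive_code a /\ x = code_point f a.
Proof.
split=> [[a0 ax]|[a0 ->]]; last by split => //; exact: code_cvg.
split => //; apply: (@cvg_unique _ (@Rhausdorff R) _ _ _ _ ax (code_cvg a0)).
Qed.

(** * Position of the images of the unit interval and uniqueness of codes *)

Definition img_lo i : R := Num.min (f i 0) (f i 1).
Definition img_hi i : R := Num.max (f i 0) (f i 1).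

(** A continuous injective map of an interval is monotone, in one direction or the other. *)
Lemma img_between i x : (0 < i)%N -> 0 <= x <= 1 -> img_lo i <= f i x <= img_hi i.
Proof.
move=> i0 /andP[x0 x1].
have finj : {in `[0, 1] &, injective (f i)}.
  by move=> u v /[!in_itv]/= u01 v01; exact: ifs_inj.
have I0 : (0:R) \in `[0, 1] by rewrite in_itv /= lexx ler01.
have I1 : (1:R) \in `[0, 1] by rewrite in_itv /= lexx ler01.
have Ix : x \in `[0, 1] by rewrite in_itv /= x0.
rewrite /img_lo /img_hi; have [f01|/ltW f10] := leP (f i 0) (f i 1).
  have m := segment_continuous_inj_le f01 (ifs_continuous i0) finj.
  by rewrite !(m _ _) // x0.
have m := segment_continuous_inj_ge f10 (ifs_continuous i0) finj.
by rewrite !(m _ _) // x0 x1.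
Qed.

Lemma img_IVT i v : (0 < i)%N -> img_lo i < v < img_hi i ->
  exists2 x, 0 < x < 1 & f i x = v.
Proof.
move=> i0 /andP[lv vh].
have [|x /[!in_itv]/= /andP[x0 x1] xv] := IVT (@ler01 R) (ifs_continuous i0) (v := v).
  by rewrite !ltW.
exists x => //; rewrite !lt_neqAle x0 x1 !andbT; apply/andP; split; apply/eqP => xE.
  move: lv vh; rewrite /img_lo /img_hi -xv -xE gt_min lt_max ltxx /=; lra.
move: lv vh; rewrite /img_lo /img_hi -xv xE gt_min lt_max ltxx ?orbF /=; lra.
Qed.

(** The open set condition speaks of interior points only. If [f j y] were strictly inside the image
    of [f i], moving [y] slightly into the open interval would keep it there and produce a forbidden
    common value. *)
Lemma img_disjoint i j y : (0 < i)%N -> (0 < j)%N -> i != j -> 0 <= y <= 1 ->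
  f j y <= img_lo i \/ img_hi i <= f j y.
Proof.
move=> i0 j0 ij /andP[y0 y1].
have [lv|?] := ltP (img_lo i) (f j y); last by left.
have [vh|?] := ltP (f j y) (img_hi i); last by right.
exfalso; have [l l0 lip] := ifs_lipschitz j0.
set r := Num.min (f j y - img_lo i) (img_hi i - f j y).
have r0 : 0 < r by rewrite lt_min !subr_gt0 lv.
set h := Num.min 1 (r / l).
have h0 : 0 < h by rewrite lt_min ltr01 divr_gt0.
have h1 : h <= 1 by rewrite ge_min lexx.
have hl : h * l <= r by rewrite -ler_pdivlMr // ge_min lexx orbT.
(* Pulling [y] towards the midpoint with weight [h] makes it interior and moves it by at most
   [h / 2]. *)
pose z := (1 - h) * y + h / 2.
have z01 : 0 < z < 1 by rewrite /z; apply/andP; split; nra.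
have zc : 0 <= z <= 1 by case/andP: z01 => /ltW -> /ltW ->.
have zy : `|f j z - f j y| < r.
  apply: le_lt_trans (lip _ _ zc (introT andP (conj y0 y1))) _.
  have : `|z - y| <= h / 2.
    by rewrite /z ler_norml; apply/andP; split; nra.
  move=> zyh; have : l * `|z - y| <= l * (h / 2) by rewrite ler_wpM2l // ltW.
  nra.
have zJ : img_lo i < f j z < img_hi i.
  move: zy; rewrite lt_min ltr_norml => /andP[z1 z2].
  move: z1 z2; rewrite !ltr_norml; lra.
have [x x01 xz] := img_IVT i0 zJ.
have : (f i @` `]0, 1[%classic `&` f j @` `]0, 1[%classic) (f j z).
  by split; [exists x|exists z] => //=; rewrite in_itv.
by rewrite (gl_open_set hf) //; exact/eqP.
Qed.

(* [f j y'] lies outside the open interval [f i (0, 1)], so between it and [f i y] there is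
   an endpoint of that interval. *)
Lemma img_separation i j c y y' : (0 < i)%N -> (0 < j)%N -> i != j ->
  0 <= c -> expands c i -> 0 <= y <= 1 -> 0 <= y' <= 1 ->
  c * Num.min y (1 - y) <= `|f i y - f j y'|.
Proof.
move=> i0 j0 ij c0 ex y01 y'01.
have e0 := ex _ _ y01 zero01; have e1 := ex _ _ y01 one01.
have m0 : c * Num.min y (1 - y) <= `|f i y - f i 0|.
  apply: le_trans e0; rewrite ler_wpM2l // ge_min.
  by rewrite subr0 ler_norm.
have m1 : c * Num.min y (1 - y) <= `|f i y - f i 1|.
  apply: le_trans e1; rewrite ler_wpM2l // ge_min.
  by rewrite distrC ler_norm orbT.
have := img_between i0 y01; have := img_disjoint i0 j0 ij y'01.
rewrite /img_lo /img_hi; case: (leP (f i 0) (f i 1)) => f01.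
  move=> [h /andP[h1 h2]|h /andP[h1 h2]].
    apply: le_trans m0 _; rewrite !ger0_norm ?subr_ge0 //; first by rewrite lerB.
    exact: le_trans h h1.
  apply: le_trans m1 _; rewrite !ler0_norm ?subr_le0 // ?lerN2; first by rewrite lerB.
  exact: le_trans h2 h.
move=> [h /andP[h1 h2]|h /andP[h1 h2]].
  apply: le_trans m1 _; rewrite !ger0_norm ?subr_ge0 //; first by rewrite lerB.
  exact: le_trans h h1.
apply: le_trans m0 _; rewrite !ler0_norm ?subr_le0 // ?lerN2; first by rewrite lerB.
exact: le_trans h2 h.
Qed.

Lemma img_width i c : (0 < i)%N -> expands c i -> c <= img_hi i - img_lo i.
Proof.
move=> i0 /(_ _ _ one01 zero01); rewrite subr0 normr1 mulr1 => /le_trans; apply.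
rewrite /img_hi /img_lo; case: (leP (f i 0) (f i 1)) => f01.
  by rewrite ger0_norm ?subr_ge0.
by rewrite ltr0_norm ?subr_lt0 // opprB.
Qed.

Lemma img_hi_le i j x : (0 < i)%N -> (i < j)%N -> 0 <= x <= 1 -> img_hi j <= f i x.
Proof.
move=> i0 ij x01; have j0 : (0 < j)%N by exact: leq_trans ij.
have [|le_lo|//] := img_disjoint j0 i0 _ x01; first by rewrite gtn_eqF.
have /andP[lo_le _] := img_between j0 x01.
by have := gl_order hf i0 ij x01; rewrite ltNge (le_trans le_lo).
Qed.

Lemma img_le_lo i j x : (0 < i)%N -> (i < j)%N -> 0 <= x <= 1 -> f j x <= img_lo i.
Proof.
move=> i0 ij x01; have j0 : (0 < j)%N by exact: leq_trans ij.
have [|//|hi_le] := img_disjoint i0 j0 _ x01; first by rewrite ltn_eqF.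
have /andP[_ le_hi] := img_between i0 x01.
by have := gl_order hf i0 ij x01; rewrite ltNge (le_trans le_hi).
Qed.

(** The image of the next digit, of length at least [c], lies between 0 and the image of digit
    [i]. *)
Lemma ifs_ge_expansion i c x : (0 < i)%N -> expands c i.+1 -> 0 <= x <= 1 -> c <= f i x.
Proof.
move=> i0 ex x01; apply: le_trans (img_hi_le i0 (ltnSn i) x01).
apply: le_trans (img_width _ ex) _ => //.
rewrite gerBl le_min.
by case/andP: (gl_stable hf (ltn0Sn i) zero01) (gl_stable hf (ltn0Sn i) one01) => -> _ /andP[].
Qed.

(** The image of digit 1, of length at least [c], lies to the right of all the others. *)
Lemma ifs_le_expansion i c x : (1 < i)%N -> expands c 1 -> 0 <= x <= 1 ->
  f i x <= 1 - c.
Proof.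
move=> i1 ex x01; apply: le_trans (img_le_lo (ltn0Sn 0) i1 x01) _.
have := img_width (ltn0Sn 0) ex.
suff : img_hi 1 <= 1 by lra.
rewrite ge_max.
by case/andP: (gl_stable hf (ltn0Sn 0) zero01) (gl_stable hf (ltn0Sn 0) one01) => _ -> /andP[].
Qed.

Lemma code_point_digit0 a b : positive_code a -> positive_code b ->
  code_point f a = code_point f b -> a 0 = b 0.
Proof.
move=> a0 b0 E; apply/eqP/negP => /negP ab.
(* If the first digits differ, [img_separation] forces the tail to be 0 or 1, and tails are
   positive. Applied to both codes, it leaves the values of two different maps at 1, which
   [gl_order] keeps apart. *)
have one a' b' : positive_code a' -> positive_code b' -> a' 0 != b' 0 ->
    code_point f a' = code_point f b' -> code_point f (shift_code a') = 1.
  move=> a'0 b'0 ab' E'; have sa := positive_shift a'0; have sb := positive_shift b'0.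
  have [c c0 ex] := expands_pos (a'0 0).
  have := img_separation (a'0 0) (b'0 0) ab' (ltW c0) ex (code_point01 sa) (code_point01 sb).
  rewrite -!code_pointS // E' subrr normr0 pmulr_rle0 // ge_min.
  rewrite leNgt code_point_gt0 //= => h.
  have := code_point01 sa; lra.
have ba : b 0 != a 0 by rewrite eq_sym.
have := E; rewrite (code_pointS a0) (code_pointS b0) (one _ _ a0 b0 ab E) (one _ _ b0 a0 ba (esym E)).
move: ab; rewrite neq_ltn => /orP[] ab.
  by have := gl_order hf (a0 0) ab one01; lra.
by have := gl_order hf (b0 0) ab one01; lra.
Qed.

Lemma code_point_inj a b : positive_code a -> positive_code b ->
  code_point f a = code_point f b -> a = b.
Proof.
move=> a0 b0 E; apply/funext => n.
elim: n a b a0 b0 E => [|n IH] a b a0 b0 E; first exact: code_point_digit0.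
apply: (IH (shift_code a) (shift_code b)); [exact: positive_shift..|].
have sa := positive_shift a0; have sb := positive_shift b0.
apply: (ifs_inj (a0 0)); [exact: code_point01..|].
by rewrite -(code_pointS a0) E (code_pointS b0) (code_point_digit0 a0 b0).
Qed.

(** Distinct codes give distinct points, so the uniqueness demanded by [digits] is automatic. *)
Lemma digits_code_point x a : digits f x a <-> positive_code a /\ x = code_point f a.
Proof.
split=> [[/codes_code_point//]|[a0 xa]].
split=> [|b /codes_code_point[b0 xb]]; first exact/codes_code_point.
by apply: code_point_inj; rewrite // -xa.
Qed.

End GaussLike.

(** * Covers and Hausdorff measure *)

Section HausdorffCovers.
Context {R : realType}.
Implicit Types (s c l : R) (A B U : set R).

Lemma diam_ge0 U : U !=set0 -> (0 <= diam U)%E.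
Proof.
move=> [x Ux]; apply: ereal_sup_ubound; exists (x, x) => //=.
by rewrite subrr normr0.
Qed.

Lemma diam_ge U x y : U x -> U y -> (`|x - y|%:E <= diam U)%E.
Proof. by move=> Ux Uy; apply: ereal_sup_ubound; exists (x, y). Qed.

Lemma diam_pow_ge0 s U : (0 <= diam_pow s U)%E.
Proof. by rewrite /diam_pow; case: ifP => // _; exact: poweR_ge0. Qed.

Lemma diam_pow_set0 s : diam_pow s (set0 : set R) = 0%E.
Proof. by rewrite /diam_pow eqxx. Qed.

Lemma diam_pow_neq0 s U : U !=set0 -> diam_pow s U = poweR (diam U) s.
Proof. by rewrite /diam_pow => /set0P/negbTE ->. Qed.

Lemma diam_pow_ge s U x y : 0 <= s -> U x -> U y ->
  ((`|x - y| `^ s)%:E <= diam_pow s U)%E.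
Proof.
move=> s0 Ux Uy; rewrite diam_pow_neq0; last by exists x.
rewrite -poweR_EFin; apply: gt0_ler_poweR => //; last exact: diam_ge.
  by rewrite in_itv /= lee_fin normr_ge0 leey.
by rewrite in_itv /= leey andbT; apply: diam_ge0; exists x.
Qed.

(** Diameters are left free: for [s > 0] a small total cost already forces them to be small. *)
Definition coverable s A c := exists U : nat -> set R,
  A `<=` \bigcup_k U k /\ (\sum_(0 <= k <oo) diam_pow s (U k) <= c%:E)%E.

Lemma coverable_sub s A B c : A `<=` B -> coverable s B c -> coverable s A c.
Proof. by move=> AB [U [BU Uc]]; exists U; split => //; exact: subset_trans AB BU. Qed.

Lemma coverable_le s A c c' : c <= c' -> coverable s A c -> coverable s A c'.
Proof.
by move=> cc [U [AU Uc]]; exists U; split => //; apply: le_trans Uc _; rewrite lee_fin.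
Qed.

(** A bijection between naturals and pairs merges the covers into one sequence; the nonnegative
    double sum may be rearranged. *)
Lemma coverable_bigcup s (A : nat -> set R) (c : nat -> R) C :
  (forall i, coverable s (A i) (c i)) -> (\sum_(0 <= i <oo) (c i)%:E <= C%:E)%E ->
  coverable s (\bigcup_i A i) C.
Proof.
move=> /choice[U Uc] cC.
have /card_set_bijP[e eb] : ([set: nat] #= [set: nat * nat])%card.
  by rewrite card_eq_sym; exact: card_nat2.
exists (fun n => U (e n).1 (e n).2); split.
  move=> x [i _ Aix]; have [/(_ _ Aix)[k _ Uikx] _] := Uc i.
  have [n _ en] := set_bij_surj eb (I : [set: nat * nat] (i, k)).
  by exists n => //; rewrite en.
apply: le_trans cC.
rewrite nneseries_esumT; last by move=> n; exact: diam_pow_ge0.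
rewrite -(reindex_esum _ _ _ (fun p : nat * nat => diam_pow s (U p.1 p.2)) eb).
have -> : [set: nat * nat] = [set: nat] `*`` (fun=> [set: nat]).
  by apply/seteqP; split.
rewrite -(@esum_esum _ _ _ _ _ (fun i k => diam_pow s (U i k))); last first.
  by move=> *; exact: diam_pow_ge0.
rewrite -nneseries_esumT; last by move=> n; apply: esum_ge0 => *; exact: diam_pow_ge0.
apply: lee_nneseries => [i _ _|i _]; first by apply: esum_ge0 => *; exact: diam_pow_ge0.
rewrite -nneseries_esumT; last by move=> n; exact: diam_pow_ge0.
by have [] := Uc i.
Qed.

Lemma coverable_set0 s : coverable s set0 0.
Proof.
exists (fun=> set0); split => //.
by rewrite eseries0 // => *; exact: diam_pow_set0.
Qed.

Lemma coverable_setU s A B c c' : 0 <= c -> 0 <= c' ->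
  coverable s A c -> coverable s B c' ->
  coverable s (A `|` B) (c + c').
Proof.
move=> c0 c'0 Ac Bc; rewrite -bigcup2E.
pose e n := if n is 0 then c else if n is 1 then c' else 0.
apply: (@coverable_bigcup _ _ e); first by case=> [|[|n]] //=; exact: coverable_set0.
rewrite (@nneseries_split _ _ 0 2); last by case=> [|[|n]] _; rewrite lee_fin.
rewrite eseries0 => [|[|[|n]]//]. 
by rewrite adde0 big_nat_recr //= big_nat1.
Qed.

Lemma coverable_image s A c l (g : R -> R) : 0 <= s -> 0 < l ->
  (forall x y, A x -> A y -> `|g x - g y| <= l * `|x - y|) ->
  coverable s A c -> coverable s (g @` A) (l `^ s * c).
Proof.
move=> s0 l0 lip [U [AU Uc]].
(* The covering sets are cut down to [A], since [g] is Lipschitz only there. *)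
exists (fun k => g @` (A `&` U k)); split.
  move=> _ [x Ax <-]; have [k _ Ukx] := AU _ Ax.
  by exists k => //; exists x.
apply: (@le_trans _ _ ((l `^ s)%:E * \sum_(0 <= k <oo) diam_pow s (U k))%E); last first.
  by rewrite EFinM lee_wpmul2l // lee_fin powR_ge0.
rewrite -nneseriesZl; last by move=> *; exact: diam_pow_ge0.
apply: lee_nneseries => [*|k _]; first exact: diam_pow_ge0.
have [->|/set0P[_ [x [Ax Ux] _]]] := eqVneq (g @` (A `&` U k)) set0.
  by rewrite diam_pow_set0 mule_ge0 ?lee_fin ?powR_ge0 ?diam_pow_ge0.
have gn : (g @` (A `&` U k)) !=set0 by exists (g x); exists x.
have Un : U k !=set0 by exists x.
rewrite !diam_pow_neq0 // -poweR_EFin -poweRM ?lee_fin ?(ltW l0) ?diam_ge0 //.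
have l0' : (0 <= l%:E)%E by rewrite lee_fin ltW.
apply: gt0_ler_poweR => //.
- by rewrite in_itv /= leey andbT; exact: diam_ge0.
- by rewrite in_itv /= leey andbT mule_ge0 // diam_ge0.
- apply: ge_ereal_sup => _ [[_ _] [[y [Ay Uy] <-] [z [Az Uz] <-]] <-] /=.
  apply: (@le_trans _ _ (l * `|y - z|)%:E); first by rewrite lee_fin lip.
  by rewrite EFinM lee_wpmul2l // diam_ge.
Qed.

Lemma coverable_single s U c : (diam_pow s U <= c%:E)%E -> coverable s U c.
Proof.
move=> Uc; exists (fun k => if k is 0 then U else set0); split.
  by move=> x Ux; exists 0.
rewrite (@nneseries_split _ _ 0 1); last by move=> *; exact: diam_pow_ge0.
rewrite eseries0 => [|[|k]// _ _]; last exact: diam_pow_set0.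
by rewrite big_nat1 adde0.
Qed.

Definition null_cover s A := forall e, 0 < e -> coverable s A e.

Lemma null_cover_bigcup s (A : nat -> set R) :
  (forall i, null_cover s (A i)) -> null_cover s (\bigcup_i A i).
Proof.
move=> A0 e e0.
apply: (@coverable_bigcup _ _ (fun i => e / (2 ^ (i.+1))%:R)).
  by move=> i; apply: A0; rewrite divr_gt0 // ltr0n expn_gt0.
have := epsilon_trick0 xpredT (ltW e0).
by [].
Qed.

Lemma null_cover_sub s A B : A `<=` B -> null_cover s B -> null_cover s A.
Proof. by move=> AB B0 e e0; apply: coverable_sub AB (B0 _ e0). Qed.

Lemma null_cover_image s A l (g : R -> R) : 0 <= s -> 0 < l ->
  (forall x y, A x -> A y -> `|g x - g y| <= l * `|x - y|) ->
  null_cover s A -> null_cover s (g @` A).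
Proof.
move=> s0 l0 lip A0 e e0; have ls0 : 0 < l `^ s by exact: powR_gt0.
rewrite -(@divfK _ (l `^ s) _ e) ?gt_eqF // mulrC.
by apply: coverable_image => //; apply: A0; exact: divr_gt0.
Qed.

Lemma null_cover_hausdorff s A : 0 < s -> null_cover s A -> hausdorff_measure s A = 0%E.
Proof.
move=> s0 A0; apply/eqP; rewrite eq_le; apply/andP; split; last first.
  apply: (@le_trans _ _ (hausdorff_premeasure s 1 A)).
    apply: le_ereal_inf_tmp => _ [U _ <-]; apply: nneseries_ge0 => *; exact: diam_pow_ge0.
  by apply: ereal_sup_ubound; exists 1 => //=.
apply: ge_ereal_sup => _ [r /= r0 <-].
apply/lee_addgt0Pr => e e0; rewrite add0e.
(* Each single term is at most the total cost, so a cost of at most [r] to the power [s] keeps every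
   diameter within [r]. *)
have [U [AU Ue]] := A0 (Num.min e (r `^ s)) ltac:(by rewrite lt_min e0 powR_gt0).
apply: (@le_trans _ _ (\sum_(0 <= k <oo) diam_pow s (U k))%E); last first.
  by apply: le_trans Ue _; rewrite lee_fin ge_min lexx.
apply: ereal_inf_lbound; exists U => //; split => // k.
have [->|/set0P Un] := eqVneq (U k) set0.
  by apply: ge_ereal_sup => _ [p [[]]].
have : (diam_pow s (U k) <= (r `^ s)%:E)%E.
  apply: (@le_trans _ _ (Num.min e (r `^ s))%:E); last by rewrite lee_fin ge_min lexx orbT.
  apply: le_trans Ue.
  rewrite nneseries_esumT; last by move=> *; exact: diam_pow_ge0.
  by apply: esum_ge; exists [set k]; [split|rewrite fsbig_set1].
rewrite diam_pow_neq0 // => h.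
rewrite leNgt; apply/negP => rd.
move: h; rewrite leNgt => /negP; apply.
case: (diam (U k)) rd (diam_ge0 Un) => [u||] //= ru u0.
  by rewrite lte_fin gt0_ltr_powR // nnegrE ?ltW // -lte_fin.
by rewrite gt_eqF // ltry.
Qed.

Lemma hausdorff_measure0_coverable s A : hausdorff_measure s A = 0%E ->
  null_cover s A.
Proof.
move=> A0 e e0.
have : (hausdorff_premeasure s 1 A < e%:E)%E.
  apply: (@le_lt_trans _ _ 0%E); last by rewrite lte_fin.
  rewrite -A0; apply: ereal_sup_ubound; exists 1 => //=.
by move=> /ereal_inf_lt[_ [U [AU _] <-] Ue]; exists U; split => //; exact: ltW.
Qed.

End HausdorffCovers.

(** * Upper bound *)

Section PowerSeries.
Context {R : realType}.
Implicit Types (p q c : R) (n N : nat).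

(* From [ln (1 + h) <= h] and [1 + h <= exp h]. *)
Lemma powR_telescope q n : 0 < q ->
  q * n.+2%:R `^ (- (1 + q)) <= n.+1%:R `^ (- q) - n.+2%:R `^ (- q).
Proof.
move=> q0; set u : R := n.+1%:R; set v : R := n.+2%:R.
have u0 : 0 < u by rewrite ltr0n.
have v0 : 0 < v by rewrite ltr0n.
have lnuv : 1 / v <= ln v - ln u.
  have uv : u / v = 1 - 1 / v.
    have -> : v = u + 1 by rewrite /u /v natr1.
    by field; rewrite gt_eqF // addr_gt0.
  have := @le_ln1Dx R (- (1 / v)); rewrite -uv.
  have : -1 < - (1 / v).
    by rewrite ltrN2 div1r invf_lt1 // ltr1n.
  move=> /[swap] /[apply]; rewrite lnM ?posrE ?invr_gt0 // lnV ?posrE //.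
  by rewrite -(opprB (ln u)) lerNr.
clearbody u v.
have -> : u `^ (- q) = v `^ (- q) * expR (q * (ln v - ln u)).
  rewrite /powR !gt_eqF // -expRD; congr expR; ring.
have -> : v `^ (- (1 + q)) = v `^ (- q) / v.
  have -> : - (1 + q) = - q + - 1 by ring.
  rewrite powRD; last by rewrite (gt_eqF v0) implybT.
  by rewrite (powRN v 1) powRr1 ?(ltW v0).
have h2 := expR_ge1Dx (q * (ln v - ln u)).
have h1 : q / v <= q * (ln v - ln u) by rewrite ler_pM2l // -div1r.
have vq : 0 < v `^ (- q) by exact: powR_gt0.
rewrite mulrCA -[X in _ <= _ - X]mulr1 -mulrBr ler_pM2l //.
by rewrite lerBrDl (le_trans _ h2) // lerD2l.
Qed.

Lemma powR_series_tail q N : 0 < q -> (0 < N)%N ->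
  (\sum_(N <= i <oo) (i.+1%:R `^ (- (1 + q)))%:E <= (q^-1 * N%:R `^ (- q))%:E)%E.
Proof.
move=> q0; case: N => // N _.
apply: lime_le; first by apply: is_cvg_nneseries => *; rewrite lee_fin powR_ge0.
apply: nearW => n; rewrite sumEFin lee_fin -ler_pdivrMl ?invr_gt0 // invrK.
have [nN|Nn] := leqP n N.+1; first by rewrite big_geq // mulr0 powR_ge0.
apply: (@le_trans _ _ (N.+1%:R `^ (- q) - n%:R `^ (- q))); last first.
  by rewrite gerBl powR_ge0.
rewrite mulr_sumr; elim: n Nn => // n IH; rewrite ltnS leq_eqVlt => /orP[/eqP <-|Nn].
  by rewrite big_nat1; exact: powR_telescope.
rewrite big_nat_recr /=; last exact: ltnW.
have := IH Nn; case: n Nn {IH} => // n _ h.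
have := powR_telescope n q0; lra.
Qed.

Lemma powR_series q : 0 < q ->
  (\sum_(0 <= i <oo) (i.+1%:R `^ (- (1 + q)))%:E <= (1 + q^-1)%:E)%E.
Proof.
move=> q0; rewrite (@nneseries_split _ _ 0 1); last by move=> *; rewrite lee_fin powR_ge0.
rewrite big_nat1 powR1 EFinD leeD2l //.
by have := powR_series_tail q0 (ltn0Sn 0); rewrite powR1 mulr1.
Qed.

Lemma powRN_small q e : 0 < q -> 0 < e -> exists2 N, (0 < N)%N & N%:R `^ (- q) <= e.
Proof.
move=> q0 e0; exists (Num.truncn (e^-1 `^ q^-1)).+1 => //.
rewrite powRN -[leRHS]invrK lef_pV2 ?posrE ?invr_gt0 ?powR_gt0 ?ltr0n //.
have E : (e^-1 `^ q^-1) `^ q = e^-1.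
  by rewrite -powRrM mulVf ?gt_eqF // powRr1 // invr_ge0 ltW.
rewrite -[leLHS]E; apply: ge0_ler_powR; rewrite ?nnegrE ?powR_ge0 ?(ltW q0) //.
exact/ltW/truncnS_gt.
Qed.

End PowerSeries.

(** * Covers of the points whose digits are recurrently large *)

Section UpperBound.
Context {R : realType} {d : R} {f : nat -> R -> R}.
Hypothesis hf : gauss_like_ifs d f.
Variable m : nat.
Implicit Types (a : nat -> nat) (M j n : nat).

Definition recurrently_large M a :=
  forall n, exists2 k, (k <= m)%N & (M < a (n + k))%N.

Definition large_set M : set R :=
  [set code_point f a | a in [set a | positive_code a /\ recurrently_large M a]].

(** The bound [j] on the position of a large digit is the induction parameter of the covering
    argument. *)
Definition large_within M j : set R :=
  [set code_point f a | a in
    [set a | [/\ positive_code a, recurrently_large M a &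
      exists2 k, (k <= j)%N & (M < a k)%N]]].

Definition eventually_large M n : set R :=
  [set code_point f a | a in
    [set a | positive_code a /\ recurrently_large M (fun k => a (n + k)%N)]].

Lemma recurrently_large_shift M a : recurrently_large M a ->
  recurrently_large M (shift_code a).
Proof. by move=> aM n; have [k km] := aM n.+1; exists k. Qed.

Lemma large_set01 M x : large_set M x -> 0 <= x <= 1.
Proof. by move=> [a [a0 _] <-]; exact: code_point01 hf a a0. Qed.

Lemma large_within01 M j x : large_within M j x -> 0 <= x <= 1.
Proof. by move=> [a [a0 _ _] <-]; exact: code_point01 hf a a0. Qed.

Lemma eventually_large01 M n x : eventually_large M n x -> 0 <= x <= 1.
Proof. by move=> [a [a0 _] <-]; exact: code_point01 hf a a0. Qed.

Lemma large_set_within M : large_set M `<=` large_within M m.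
Proof. by move=> _ [a [a0 aM] <-]; exists a => //; split => //; exact: (aM 0). Qed.

(* The index [i] stands for the digit [i.+1]. *)
Lemma large_within0_sub M : large_within M 0 `<=`
  \bigcup_i f i.+1 @` (if (M <= i)%N then large_set M else set0).
Proof.
move=> _ [a [a0 aM [k k0 Mk]] <-]; move: k0 Mk; rewrite leqn0 => /eqP-> Mk.
have a0E : (a 0).-1.+1 = a 0 by rewrite prednK.
exists (a 0).-1 => //; rewrite a0E -ltnS a0E Mk.
exists (code_point f (shift_code a)); last by rewrite -(code_pointS hf).
by exists (shift_code a) => //; split; [exact: positive_shift|exact: recurrently_large_shift].
Qed.

(** If the large digit is not the first one, dropping the first digit brings it one place closer. *)
Lemma large_withinS_sub M j : large_within M j.+1 `<=`
  large_within M 0 `|` \bigcup_i f i.+1 @` large_within M j.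
Proof.
move=> _ [a [a0 aM [[|k] kj Mk]] <-].
  by left; exists a => //; split => //; exists 0.
right; exists (a 0).-1 => //; rewrite prednK //.
exists (code_point f (shift_code a)); last by rewrite -(code_pointS hf).
exists (shift_code a) => //; split; [exact: positive_shift|exact: recurrently_large_shift|].
by exists k.
Qed.

Lemma eventually_largeS_sub M n : eventually_large M n.+1 `<=`
  \bigcup_i f i.+1 @` eventually_large M n.
Proof.
move=> _ [a [a0 aM] <-].
exists (a 0).-1 => //; rewrite prednK //.
exists (code_point f (shift_code a)); last by rewrite -(code_pointS hf).
by exists (shift_code a) => //; split => //; exact: positive_shift.
Qed.

Lemma large_set_null s : 0 < s -> 1 < d * s -> exists2 M, (0 < M)%N & null_cover s (large_set M).
Proof.
move=> s0 ds1; pose q := (d * s - 1) / 2.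
have q0 : 0 < q by rewrite divr_gt0 // subr_gt0.
have e0 : 0 < q / s by rewrite divr_gt0.
have [C1 [C2 [_ C20 lip]]] := ifs_bilipschitz hf e0.
pose lam i : R := C2 * i.+1%:R `^ (- (d - q / s)).
have lam0 i : 0 < lam i by rewrite mulr_gt0 // powR_gt0 // ltr0n.
have lamE i : lam i `^ s = C2 `^ s * i.+1%:R `^ (- (1 + q)).
  rewrite /lam powRM ?ltW ?powR_gt0 ?ltr0n // -powRrM; congr (_ * _ `^ _).
  rewrite mulNr mulrBl divfK ?gt_eqF //; congr (- _); rewrite /q; lra.
have lipl i x y : 0 <= x <= 1 -> 0 <= y <= 1 -> `|f i.+1 x - f i.+1 y| <= lam i * `|x - y|.
  by move=> x01 y01; have [_] := lip i.+1 (ltn0Sn i); apply.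
have step (B : nat -> set R) (c : nat -> R) C :
    (forall i x, B i x -> 0 <= x <= 1) -> (forall i, coverable s (B i) (c i)) ->
    (\sum_(0 <= i <oo) (lam i `^ s * c i)%:E <= C%:E)%E ->
    coverable s (\bigcup_i f i.+1 @` B i) C.
  move=> B01 Bc; apply: coverable_bigcup => i.
  apply: coverable_image; rewrite ?ltW // => x y /B01 x01 /B01 y01; exact: lipl.
pose D := C2 `^ s; have D0 : 0 < D by exact: powR_gt0.
(* [Z] bounds the sum over all digits of the Lipschitz constants to the power [s], the price of one
   arbitrary digit; [K j] accumulates this price over up to [j] digits preceding the large one. *)
pose Z := D * (1 + q^-1).
pose fix K j : R := if j is j'.+1 then 1 + Z * K j' else 1.
have Z0 : 0 < Z by rewrite mulr_gt0 // addr_gt0 // invr_gt0.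
have K0 j : 0 < K j by elim: j => //= j IH; rewrite addr_gt0 // mulr_gt0.
have [M M0 MK] : exists2 M, (0 < M)%N & M%:R `^ (- q) <= q / (2 * D * K m).
  by apply: powRN_small; rewrite // divr_gt0 // !mulr_gt0.
(* [tau] bounds the same sum restricted to digits above [M]; the choice of [M] makes the total
   factor [tau * K m] at most one half. *)
exists M => //; pose tau := D * (q^-1 * M%:R `^ (- q)).
have tau0 : 0 < tau by rewrite !mulr_gt0 ?invr_gt0 ?powR_gt0 // ltr0n.
have tauK : tau * K m <= 1 / 2.
  move: MK; rewrite ler_pdivlMr ?mulr_gt0 // => MK.
  rewrite /tau -(ler_pM2l q0) !mulrA.
  suff -> : q * D / q * M%:R `^ (- q) * K m = (M%:R `^ (- q) * (2 * D * K m)) * (1 / 2).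
    by move: MK; lra.
  by field; rewrite gt_eqF.
have within0 c : 0 < c -> coverable s (large_set M) c -> coverable s (large_within M 0) (tau * c).
  move=> c0 Gc; apply: coverable_sub (@large_within0_sub M) _.
  apply: (step _ (fun i => if (M <= i)%N then c else 0)).
  - by move=> i x; case: ifP => // _; exact: large_set01.
  - by move=> i; case: ifP => // _; exact: coverable_set0.
  have t0 i : (0 <= (lam i `^ s * (if (M <= i)%N then c else 0))%:E)%E.
    by rewrite lee_fin mulr_ge0 ?powR_ge0 //; case: ifP; rewrite // ltW.
  rewrite (@nneseries_split _ _ 0 M) // add0n big_nat big1; last first.
    by move=> i /andP[_ iM]; rewrite leqNgt iM mulr0.
  rewrite add0e; apply: (@le_trans _ _ (\sum_(M <= i <oo) (D * c)%:E * (i.+1%:R `^ (- (1 + q)))%:E)%E).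
    apply: lee_nneseries => [i _ _|i _]; first exact: t0.
    rewrite lamE -EFinM lee_fin mulrAC ler_wpM2r ?powR_ge0 // ler_wpM2l ?(ltW D0) //.
    by case: ifP => // _; exact: ltW.
  rewrite nneseriesZl; last by move=> *; rewrite lee_fin powR_ge0.
  have -> : tau * c = (D * c) * (q^-1 * M%:R `^ (- q)) by rewrite /tau; ring.
  rewrite [leRHS]EFinM; apply: lee_wpmul2l; first by rewrite lee_fin mulr_ge0 // ltW.
  exact: powR_series_tail.
have within j c : 0 < c -> coverable s (large_set M) c ->
    coverable s (large_within M j) (tau * K j * c).
  move=> c0 Gc; elim: j => [|j IH]; first by rewrite /= mulr1; exact: within0.
  apply: coverable_sub (@large_withinS_sub M j) _.
  have -> : tau * K j.+1 * c = tau * c + Z * (tau * K j * c) by rewrite /=; ring.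
  have r0 : 0 < tau * K j * c := mulr_gt0 (mulr_gt0 tau0 (K0 j)) c0.
  apply: coverable_setU; [by rewrite mulr_ge0 // ltW..| |]; rewrite ?mulr_ge0 ?ltW //.
    exact: within0.
  apply: (step _ (fun=> tau * K j * c)) => //; first by move=> i x; exact: large_within01.
  under eq_eseriesr do rewrite lamE mulrAC EFinM.
  rewrite nneseriesZl; last by move=> *; rewrite lee_fin powR_ge0.
  rewrite /Z [D * _ * _]mulrAC [leRHS]EFinM; apply: lee_wpmul2l.
    by rewrite lee_fin mulr_ge0 // ltW.
  exact: powR_series.
(* The iteration starts from the unit interval as a single covering set. *)
have G1 : coverable s (large_set M) 1.
  apply: (@coverable_sub _ _ _ `[0, 1]).
    by move=> x /large_set01; rewrite /= in_itv.
  apply: coverable_single; rewrite diam_pow_neq0; last first.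
    by exists 0; rewrite /= in_itv /= lexx ler01.
  have -> : 1%:E = poweR (1%:E : \bar R) s by rewrite poweR_EFin powR1.
  apply: gt0_ler_poweR; rewrite ?(ltW s0) //.
  - rewrite in_itv /= leey andbT; apply: diam_ge0.
    by exists 0; rewrite /= in_itv /= lexx ler01.
  - by rewrite in_itv /= leey lee_fin ler01.
  - apply: ge_ereal_sup => _ [[x y] [/= + +] <-]; rewrite !in_itv /= => x01 y01.
    by rewrite lee_fin ler_norml; apply/andP; split; lra.
have Gn n : coverable s (large_set M) ((1 / 2) ^+ n).
  elim: n => [|n IH]; first by rewrite expr0.
  apply: coverable_sub (@large_set_within M) _.
  apply: coverable_le (within m _ _ IH); last by rewrite exprn_gt0.
  by rewrite exprS ler_wpM2r // exprn_ge0.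
move=> e e0'.
have /cvgrPdist_lt/(_ _ e0')[k _ /(_ _ (leqnn k))] : (1 / 2 : R) ^+ n @[n --> \oo] --> (0:R).
  by apply: cvg_expr; rewrite gtr0_norm //; lra.
rewrite /= sub0r normrN ger0_norm ?exprn_ge0 // => ke.
exact: coverable_le (ltW ke) (Gn k).
Qed.

(** Each free initial digit adds a countable union of Lipschitz images, which preserves null
    covers. *)
Lemma eventually_large_null s M : 0 <= s -> null_cover s (large_set M) ->
  forall n, null_cover s (eventually_large M n).
Proof.
move=> s0 G0; elim=> [|n IH].
  by apply: null_cover_sub G0 => _ [a [a0 aM] <-]; exists a.
apply: null_cover_sub (@eventually_largeS_sub M n) _.
apply: null_cover_bigcup => i; have [l l0 lip] := ifs_lipschitz hf (ltn0Sn i).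
apply: null_cover_image s0 l0 _ IH => x y.
by move=> /eventually_large01 x01 /eventually_large01 y01; exact: lip.
Qed.

(** Some exponent [s] makes the series converge. A window with all digits at most [M] contributes a
    term of at least [P] to the power [- s], so beyond some index no such window occurs. *)
Lemma tau2_finite_large (t : 'I_m.+1 -> R) a M : (forall i, 0 <= t i) -> (0 < M)%N ->
  positive_code a -> (tau2 t a < +oo)%E ->
  exists n, recurrently_large M (fun k => a (n + k)%N).
Proof.
move=> t0 M0 a0 /ereal_inf_lt[_ [s [s0 sfin] <-] _].
set u := (X in (\sum_(0 <= n <oo) (X n)%:E < _)%E) in sfin.
pose P : R := \prod_(i < m.+1) M%:R `^ t i.
have P0 : 0 < P by apply: prodr_gt0 => i _; rewrite powR_gt0 // ltr0n.
have u0 n : (0 <= (u n)%:E)%E by rewrite lee_fin powR_ge0.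
have : nbhs (0 : \bar R) [set x | x < (P `^ (- s))%:E]%E.
  apply: open_nbhs_nbhs; split; first exact: open_ereal_lt_ereal.
  by rewrite /= lte_fin powR_gt0.
move=> /(nneseries_tail_cvg sfin (fun n _ => u0 n))[N _ tailN].
exists N => n; apply: contrapT => small.
have {}small k : (k <= m)%N -> (a (N + n + k) <= M)%N.
  by move=> km; rewrite leqNgt; apply/negP => Ma; apply: small; exists k; rewrite // addnA.
have := tailN (N + n)%N (leq_addr _ _); rewrite /= ltNge => /negP; apply.
apply: (@le_trans _ _ (u (N + n)%N)%:E).
  have Q0 : 0 < \prod_(i < m.+1) (a (N + n + i)%N)%:R `^ t i :> R.
    by apply: prodr_gt0 => i _; rewrite powR_gt0 // ltr0n.
  rewrite lee_fin /u !powRN lef_pV2 ?posrE ?powR_gt0 //.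
  apply: ge0_ler_powR; rewrite ?nnegrE ?(ltW Q0) ?(ltW P0) //.
  rewrite /P; apply: ler_prod => i _; rewrite powR_ge0 /=.
  by apply: ge0_ler_powR; rewrite ?nnegrE ?ler0n // ler_nat small // -ltnS.
rewrite (@nneseries_split _ _ (N + n) 1) // addn1 big_nat1 leeDl //.
exact: nneseries_ge0.
Qed.


Lemma tau2_level_null (t : 'I_m.+1 -> R) (alpha s : R) : (forall i, 0 <= t i) ->
  0 < s -> 1 < d * s -> null_cover s (tau2_level f t alpha).
Proof.
move=> t0 s0 ds; have [M M0 G0] := large_set_null s0 ds.
apply: (@null_cover_sub _ _ _ (\bigcup_n eventually_large M n)); last first.
  by apply: null_cover_bigcup => n; apply: eventually_large_null; rewrite ?ltW.
move=> x [_ [a [/(digits_code_point hf)[a0 ->] ta]]].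
have [|n an] := tau2_finite_large t0 M0 a0; first by rewrite ta ltry.
by exists n => //; exists a.
Qed.

End UpperBound.

(** * Lower bound *)

Lemma powR_prod {R : realType} (n : nat) (F : nat -> R) (s : R) : (forall k, 0 <= F k) ->
  (\prod_(k < n) F k) `^ s = \prod_(k < n) F k `^ s.
Proof.
move=> F0; elim: n => [|n IH]; first by rewrite !big_ord0 powR1.
by rewrite !big_ord_recr /= powRM ?IH // prodr_ge0.
Qed.

(** Only the first [K] factors can be below 1; induction on [K] peels them off. The minimum with 1
    accounts for the empty product. *)
Lemma prod_lower_bound {R : realType} (h : nat -> R) : (forall k, 0 < h k) ->
  (exists K, forall k, (K <= k)%N -> 1 <= h k) ->
  exists2 c, 0 < c & forall n, c <= \prod_(k < n) h k.
Proof.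
move=> + [K]; elim: K h => [|K IH] h h0 hK.
  exists 1 => // n; elim: n => [|n IHn]; first by rewrite big_ord0.
  by rewrite big_ord_recr /= -[leLHS]mulr1 ler_pM // hK.
have [||c c0 hc] := IH (fun k => h k.+1); [by move=> k; exact: h0|by move=> k Kk; exact: hK|].
exists (Num.min 1 (h 0 * c)); first by rewrite lt_min ltr01 mulr_gt0.
case=> [|n]; first by rewrite big_ord0 ge_min lexx.
rewrite big_ord_recl /= ge_min; apply/orP; right.
by rewrite ler_pM2l //; exact: hc.
Qed.

(** * Mixed radix expansions of real numbers *)

Section MixedRadix.
Context {R : realType}.
Variable L : nat -> nat.
Hypothesis L2 : forall n, (1 < L n)%N.
Implicit Types (u v : R) (n k : nat).

Fixpoint radix_rem u n : R :=
  if n is n'.+1 then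
    (L n')%:R * radix_rem u n' - (Num.truncn ((L n')%:R * radix_rem u n'))%:R
  else u.

Definition radix_digit u n := Num.truncn ((L n)%:R * radix_rem u n).

Lemma radix_rem01 u n : 0 <= u < 1 -> 0 <= radix_rem u n < 1.
Proof.
move=> u01; elim: n => //= n /andP[r0 r1].
have := @truncn_itv R ((L n)%:R * radix_rem u n).
rewrite mulr_ge0 // => /(_ isT); rewrite -natr1; set X := (_ * _); set Y := _%:R; lra.
Qed.

Lemma radix_digit_lt u n : 0 <= u < 1 -> (radix_digit u n < L n)%N.
Proof.
move=> u01; have /andP[r0 r1] := radix_rem01 n u01.
rewrite /radix_digit truncn_lt_nat ?mulr_ge0 // gtr_pMr // ltr0n.
exact: ltnW.
Qed.

(** Equal digits cancel, so each step only multiplies the difference by the radix. *)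
Lemma radix_rem_diff u v n : (forall k, (k < n)%N -> radix_digit u k = radix_digit v k) ->
  radix_rem u n - radix_rem v n = (u - v) * \prod_(k < n) (L k)%:R.
Proof.
elim: n => [|n IH] uv; first by rewrite big_ord0 mulr1.
have := uv n (ltnSn n); rewrite /radix_digit /= => ->.
rewrite big_ord_recr /= mulrA -IH; last by move=> k kn; apply: uv; exact: ltnW.
ring.
Qed.

Lemma radix_digit_agree u v n : 0 <= u < 1 -> 0 <= v < 1 ->
  (forall k, (k < n)%N -> radix_digit u k = radix_digit v k) ->
  `|u - v| * \prod_(k < n) (L k)%:R <= 1.
Proof.
move=> u01 v01 /radix_rem_diff E.
have -> : `|u - v| * \prod_(k < n) (L k)%:R = `|radix_rem u n - radix_rem v n|.
  by rewrite E normrM [X in _ = _ * X]ger0_norm // prodr_ge0.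
have := radix_rem01 n u01; have := radix_rem01 n v01.
by move=> *; rewrite ler_norml; apply/andP; split; lra.
Qed.

Lemma radix_digit_inj u v : 0 <= u < 1 -> 0 <= v < 1 ->
  (forall k, radix_digit u k = radix_digit v k) -> u = v.
Proof.
move=> u01 v01 uv; apply/eqP; rewrite -subr_eq0 -normr_le0 leNgt; apply/negP => d0.
have [N [N0 Nd]] : exists N : nat, (0 < N)%N /\ `|u - v|^-1 < N%:R.
  by exists (Num.truncn (`|u - v|^-1)).+1; split => //; exact: truncnS_gt.
have := radix_digit_agree u01 v01 (fun k (_ : (k < N)%N) => uv k).
rewrite mulrC -ler_pdivlMr // div1r leNgt => /negP; apply.
apply: lt_le_trans Nd _.
have : (N <= 2 ^ N)%N by exact/ltnW/ltn_expl.
rewrite -(ler_nat R) => /le_trans; apply.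
have -> : (2 ^ N)%N%:R = \prod_(k < N) 2 :> R by rewrite prodr_const card_ord natrX.
by apply: ler_prod => i _; rewrite ler0n ler_nat L2.
Qed.

End MixedRadix.

(** The cover is pulled back along [psi]. By the inverse Hölder bound each piece lies in an interval
    of radius [C] times its cost, and these intervals must have total length at least 1. *)
Lemma not_coverable {R : realType} (s C c : R) (A : set R) (psi : R -> R) : 0 <= s ->
  0 < C -> (forall u, 0 <= u < 1 -> A (psi u)) ->
  (forall u v, 0 <= u < 1 -> 0 <= v < 1 -> `|u - v| <= C * `|psi u - psi v| `^ s) ->
  coverable s A c -> 1 <= 2 * C * c.
Proof.
move=> s0 C0 psiA hol [U [AU Uc]].
pose V k := [set u | 0 <= u < 1 /\ U k (psi u)].
have Ufin k : diam_pow s (U k) \is a fin_num.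
  rewrite fin_numE; apply/andP; split; apply/negP => /eqP E.
    by have := diam_pow_ge0 s (U k); rewrite E.
  move: Uc; rewrite leNgt => /negP; apply.
  rewrite nneseries_esumT; last by move=> *; exact: diam_pow_ge0.
  apply: (@lt_le_trans _ _ (diam_pow s (U k))); first by rewrite E ltry.
  by apply: esum_ge; exists [set k]; [split|rewrite fsbig_set1].
pose r k := C * fine (diam_pow s (U k)).
have r0 k : 0 <= r k by rewrite mulr_ge0 ?(ltW C0) // fine_ge0 // diam_pow_ge0.
(* One centre per pulled-back piece; the value 0 for an empty piece is a mere default. *)
have /choice[v Vv] k : exists v, V k !=set0 -> V k v.
  by have [[x Vx]|nV] := pselect (V k !=set0); [exists x|exists 0 => /nV].
have cov : `[0, 1[%classic `<=` \bigcup_k `[v k - r k, v k + r k]%classic.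
  move=> u /=; rewrite in_itv /= => u01.
  have [k _ Uk] := AU _ (psiA _ u01).
  have [v01 Uv] : V k (v k) by apply: Vv; exists u.
  have : `|u - v k| <= r k.
    apply: le_trans (hol _ _ u01 v01) _; rewrite ler_pM2l //.
    by rewrite -lee_fin fineK //; exact: diam_pow_ge.
  rewrite ler_norml => h; exists k => //=; rewrite in_itv /=; lra.
have one : (1%:E <= \sum_(0 <= k <oo)
    lebesgue_measure (`[(v k - r k)%R, (v k + r k)%R]%classic : set R))%E.
  have <- : lebesgue_measure (`[0%R, 1%R[%classic : set R) = 1%:E.
    by rewrite lebesgue_measure_itv /= lte_fin ltr01 oppr0 adde0.
  by apply: (measure_sigma_subadditive (@lebesgue_measure R) _ _ cov) => [k|]; exact: measurable_itv.
rewrite -lee_fin; apply: le_trans one _.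
apply: (@le_trans _ _ (\sum_(0 <= k <oo) (2 * C)%:E * diam_pow s (U k))%E).
  apply: lee_nneseries => [*|k _]; first exact: measure_ge0.
  rewrite lebesgue_measure_itv /=; case: ifP => _; last first.
    by rewrite mule_ge0 ?diam_pow_ge0 // lee_fin mulr_ge0 // ltW.
  rewrite -(fineK (Ufin k)) -EFinD -EFinM lee_fin /r.
  by rewrite le_eqVlt; apply/orP; left; apply/eqP; ring.
rewrite nneseriesZl; last by move=> *; exact: diam_pow_ge0.
by rewrite [leRHS]EFinM lee_wpmul2l // lee_fin mulr_ge0 // ltW.
Qed.


(** * Points with digits in prescribed windows *)

Section LowerBound.
Context {R : realType} {d : R} {f : nat -> R -> R}.
Hypothesis hf : gauss_like_ifs d f.
Implicit Types (a b : nat -> nat) (n : nat).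

(* The tails after the first difference stay at distance at least [g (a n.+1).+1] from [0]
   and [1], because [a n.+1 > 1]. *)
Lemma code_separation (g : nat -> R) n a b :
  (forall i, (0 < i)%N -> 0 <= g i <= g 1 /\ expands (f := f) (g i) i) ->
  (forall k, (1 < a k)%N) -> (forall k, (1 < b k)%N) ->
  (forall k, (k < n)%N -> a k = b k) -> a n <> b n ->
  (\prod_(k < n.+1) g (a k)) * g (a n.+1).+1 <= `|code_point f a - code_point f b|.
Proof.
move=> gex; elim: n a b => [|n IH] a b a2 b2 ab abn.
  have a0 : positive_code a by move=> k; exact/ltnW/a2.
  have b0 : positive_code b by move=> k; exact/ltnW/b2.
  have sa := positive_shift a0; have sb := positive_shift b0.
  rewrite big_ord_recl big_ord0 mulr1.
  have [/andP[ga0 _] exa] := gex _ (a0 0).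
  have [/andP[g0 g1] ex1] := gex _ (ltn0Sn (a 1)).
  have ex11 := (gex 1 isT).2.
  rewrite (code_pointS hf a0) (code_pointS hf b0).
  apply: le_trans (img_separation hf (a0 0) (b0 0) _ ga0 exa (code_point01 hf sa) (code_point01 hf sb)); last exact/eqP.
  apply: ler_wpM2l => //.
  have y01 := code_point01 hf (positive_shift sa).
  rewrite le_min (code_pointS hf sa); apply/andP; split.
    exact: (ifs_ge_expansion hf (sa 0) ex1 y01).
  have := ifs_le_expansion hf (a2 1) ex11 y01.
  rewrite /shift_code in g1 *; lra.
have a0 : positive_code a by move=> k; exact/ltnW/a2.
have b0 : positive_code b by move=> k; exact/ltnW/b2.
have sa := positive_shift a0; have sb := positive_shift b0.
rewrite (code_pointS hf a0) (code_pointS hf b0) -(ab 0) //.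
have [/andP[ga0 _] exa] := gex _ (a0 0).
apply: le_trans (exa _ _ (code_point01 hf sa) (code_point01 hf sb)).
rewrite big_ord_recl -mulrA; apply: ler_wpM2l => //.
apply: (IH (shift_code a) (shift_code b)) => //; try by move=> k; rewrite /shift_code.
by move=> k kn; exact: ab.
Qed.

(** Digits above 1 are what [code_separation] requires; the factor 4 makes room for [L n] plus a
    radix digit, which is below [2 * L n], with [L n] at most [2 * l n]. *)
Definition window_set (l : nat -> R) : set R :=
  [set code_point f a | a in
    [set a | forall n, (1 < a n)%N /\ l n <= (a n)%:R <= 4 * l n]].

Lemma window_set_not_null (l : nat -> R) (B s : R) :
  (forall n, 1 <= l n) -> (forall n, l n.+1 <= B * l n) ->
  (forall M, exists K, forall n, (K <= n)%N -> M <= l n) ->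
  0 <= s -> s * d < 1 -> 0 < d ->
  ~ null_cover s (window_set l).
Proof.
move=> l1 lB loo s0 sd d0.
have l0 n : 0 < l n by exact: lt_le_trans (l1 n).
have B0 : 0 < B.
  by have := lt_le_trans (l0 1) (lB 0); rewrite pmulr_lgt0.
(* Small enough that [s * (d + e) < 1]; the denominator stays positive when [s = 0]. *)
pose e := (1 - s * d) / (2 * (s + 1)).
have s1 : 0 < s + 1 by rewrite ltr_wpDl.
have e0 : 0 < e by rewrite divr_gt0 ?subr_gt0 // mulr_gt0.
have [C1 [C2 [C10 _ reg]]] := ifs_bilipschitz hf e0.
pose D := d + e.
have D0 : 0 < D by rewrite addr_gt0.
have sD : s * D < 1.
  have es : 2 * (s + 1) * e = 1 - s * d by rewrite /e mulrC divfK // gt_eqF // mulr_gt0.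
  rewrite /D mulrDr; nra.
pose g i : R := C1 * i%:R `^ (- D).
have g0 i : (0 < i)%N -> 0 < g i by move=> i0; rewrite mulr_gt0 // powR_gt0 // ltr0n.
(* The separation bound involves a digit plus one, at most [4 * l n + 1], which 8 times [l n]
   dominates. *)
pose c := C1 * 8 `^ (- D).
have c0 : 0 < c by rewrite mulr_gt0 // powR_gt0.
have gl i n : (0 < i)%N -> i%:R <= 8 * l n -> c * (l n) `^ (- D) <= g i.
  move=> i0 il; rewrite /c /g -mulrA ler_pM2l // -powRM ?(ltW (l0 n)) //.
  have i0' : 0 < i%:R :> R by rewrite ltr0n.
  have l80 : 0 < 8 * l n by rewrite mulr_gt0.
  rewrite !powRN lef_pV2 ?posrE ?powR_gt0 //.
  by apply: ge0_ler_powR; rewrite ?nnegrE ?(ltW D0) ?(ltW i0') ?(ltW l80).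
pose L n := (Num.truncn (l n)).+1.
have tl n : (0 < Num.truncn (l n))%N by rewrite truncn_gt0.
have L2 n : (1 < L n)%N by rewrite /L ltnS.
have lL n : l n <= (L n)%:R <= 2 * l n.
  have /andP[h1 h2] := truncn_itv (ltW (l0 n)).
  rewrite /L (ltW h2) /= -natr1; have := l1 n; lra.
pose a (u : R) n := (L n + radix_digit L u n)%N.
have aw u n : 0 <= u < 1 -> (1 < a u n)%N /\ l n <= (a u n)%:R <= 4 * l n.
  move=> u01; split; first by rewrite /a ltn_addr.
  have := radix_digit_lt L2 n u01; rewrite -(ltr_nat R) /a natrD => h.
  have := lL n; have : 0 <= (radix_digit L u n)%:R :> R by []; lra.
pose w k := c `^ s * l k `^ (- (s * D)).
have w0 k : 0 < w k by rewrite mulr_gt0 // powR_gt0.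
have lBn n : l n <= B ^+ n * l 0.
  elim: n => [|n IH]; first by rewrite expr0 mul1r.
  by apply: le_trans (lB n) _; rewrite exprS -mulrA ler_pM2l.
have [kap kap0 hkap] : exists2 kap, 0 < kap &
    forall n, kap <= (\prod_(k < n.+2) w k) * \prod_(k < n) l k.
  (* Two factors [w n] and [w n.+1] have no partner [l]. Each is at least a constant times [B] to
     the power [- n], and dividing by [B ^+ 2] in every [h k] reserves the factor that compensates
     them. *)
  pose h k := w k * l k / B ^+ 2.
  have h0 k : 0 < h k := divr_gt0 (mulr_gt0 (w0 k) (l0 k)) (exprn_gt0 2 B0).
  have [|c1 c10 hc1] := prod_lower_bound h0.
    (* As [s * D < 1], [h k] is a constant times a positive power of [l k]; it reaches 1 when
       [l k = M]. *)
    pose M := (B ^+ 2 / c `^ s) `^ (1 - s * D)^-1.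
    have [K lK] := loo M; exists K => k /lK Ml.
    have -> : h k = c `^ s * l k `^ (1 - s * D) / B ^+ 2.
      rewrite /h /w powRD; last by rewrite (gt_eqF (l0 k)) implybT.
      by rewrite powRr1 ?(ltW (l0 k)) //; ring.
    rewrite ler_pdivlMr ?exprn_gt0 // mul1r -ler_pdivrMl ?powR_gt0 // mulrC.
    have ME : M `^ (1 - s * D) = B ^+ 2 / c `^ s.
      rewrite -powRrM mulVf ?gt_eqF ?subr_gt0 // powRr1 //.
      by rewrite divr_ge0 ?powR_ge0 // exprn_ge0 // ltW.
    rewrite -ME; apply: ge0_ler_powR; rewrite ?nnegrE ?powR_ge0 ?(ltW (l0 k)) //.
    by rewrite subr_ge0 ltW.
  exists (c1 * ((c `^ s) ^+ 2 / (B * l 0 ^+ 2))).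
    apply: mulr_gt0 => //; apply: divr_gt0; first exact/exprn_gt0/powR_gt0.
    exact/mulr_gt0/exprn_gt0.
  have Bn : B != 0 by rewrite gt_eqF.
  have l0n : l 0 != 0 by rewrite gt_eqF.
  have BX k : B ^+ k != 0 by rewrite expf_neq0.
  move=> n.
  have -> : (\prod_(k < n.+2) w k) * \prod_(k < n) l k =
      (\prod_(k < n) h k) * (B ^+ n * B ^+ n * (w n * w n.+1)).
    have -> : \prod_(k < n) h k = (\prod_(k < n) w k) * (\prod_(k < n) l k) / (B ^+ n * B ^+ n).
      rewrite -big_split /= /h; elim: n => [|n IH]; first by rewrite !big_ord0 expr0 mulr1 divr1.
      rewrite !big_ord_recr /= IH !exprS; field; rewrite ?Bn ?BX //.
    by rewrite !big_ord_recr /=; field; rewrite ?Bn ?BX.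
  have wl k : c `^ s / (B ^+ k * l 0) <= w k.
    rewrite /w ler_pM2l ?powR_gt0 //.
    apply: (@le_trans _ _ (l k)^-1).
      by rewrite lef_pV2 ?posrE // mulr_gt0 // exprn_gt0.
    rewrite -powR_inv1 ?(ltW (l0 k)) //; apply: ler_powR => //.
    by rewrite lerN2 ltW.
  have Bn0 k : 0 < B ^+ k by rewrite exprn_gt0.
  apply: ler_pM => //; first by rewrite ltW.
    apply: divr_ge0; first exact/exprn_ge0/powR_ge0.
    by apply: mulr_ge0; rewrite ?exprn_ge0 // ltW.
  have -> : (c `^ s) ^+ 2 / (B * l 0 ^+ 2) =
     B ^+ n * B ^+ n * ((c `^ s / (B ^+ n * l 0)) * (c `^ s / (B ^+ n.+1 * l 0))).
    by rewrite (exprS B n); field; rewrite ?Bn ?BX ?l0n.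
  rewrite ler_pM2l ?mulr_gt0 //; apply: ler_pM => //;
    by rewrite ltW // divr_gt0 ?powR_gt0 // mulr_gt0.
have hol u v : 0 <= u < 1 -> 0 <= v < 1 ->
    `|u - v| <= kap^-1 * `|code_point f (a u) - code_point f (a v)| `^ s.
  move=> u01 v01; have [->|uv] := eqVneq u v.
    by rewrite subrr normr0 mulr_ge0 ?powR_ge0 // invr_ge0 ltW.
  have exn : exists n, radix_digit L u n != radix_digit L v n.
    apply: contrapT => h; move/eqP: uv; apply.
    apply: (radix_digit_inj L2 u01 v01) => k; apply/eqP/negPn/negP => hk.
    by apply: h; exists k.
  (* At the first differing digit [n], the radix expansion bounds [|u - v|] by the inverse product
     of [n] radices, while the separation of the images has [n.+2] factors; [kap] compares the
     two. *)
  case: (ex_minnP exn) => n uvn nmin.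
  have agree k : (k < n)%N -> radix_digit L u k = radix_digit L v k.
    by move=> kn; apply/eqP/negPn/negP => /nmin; rewrite leqNgt kn.
  rewrite ler_pdivlMl //.
  apply: le_trans (_ : _ <= \prod_(k < n.+2) w k) _.
    have := radix_digit_agree u01 v01 agree.
    have Pl : \prod_(k < n) l k <= \prod_(k < n) (L k)%:R.
      by apply: ler_prod => k _; rewrite ltW //=; case/andP: (lL k).
    have Pl0 : 0 < \prod_(k < n) l k by apply: prodr_gt0.
    have Pw0 : 0 < \prod_(k < n.+2) w k by apply: prodr_gt0.
    have := hkap n; have := normr_ge0 (u - v).
    move: (\prod_(k < n) l k) (\prod_(k < n) (L k)%:R) (\prod_(k < n.+2) w k) Pl Pl0 Pw0.
    move=> P Q W PQ P0 W0 z0 kW zQ.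
    apply: (@le_trans _ _ (W * (`|u - v| * P))).
      by rewrite mulrCA [W * P]mulrC mulrA mulrC -mulrA ler_wpM2l // mulrC.
    rewrite -[leRHS]mulr1 ler_pM2l //; apply: le_trans zQ; exact: ler_wpM2l.
  have gex i : (0 < i)%N -> 0 <= g i <= g 1 /\ expands (f := f) (g i) i.
    move=> i0; split; last by have [] := reg _ i0.
    rewrite ltW ?g0 //= /g ler_pM2l // powR1 powRN invf_le1 ?powR_gt0 ?ltr0n //.
    have : i%:R `^ 0 <= i%:R `^ D :> R by apply: ler_powR; rewrite ?ler1n // ltW.
    by rewrite powRr0.
  have a2 x k : 0 <= x < 1 -> (1 < a x k)%N by move=> x01; have [] := aw x k x01.
  have aagree k : (k < n)%N -> a u k = a v k by move=> kn; rewrite /a agree.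
  have aneq : a u n <> a v n by move=> /addnI E; rewrite E eqxx in uvn.
  have sep := code_separation gex (fun k => a2 u k u01) (fun k => a2 v k v01) aagree aneq.
  have : \prod_(k < n.+2) (c * l k `^ (- D)) <= `|code_point f (a u) - code_point f (a v)|.
    apply: le_trans sep; rewrite big_ord_recr /=.
    have cl0 k : 0 <= c * l k `^ (- D) by rewrite mulr_ge0 ?powR_ge0 // ltW.
    have [a1 /andP[_ a4]] := aw u n.+1 u01.
    apply: ler_pM => //; first by apply: prodr_ge0.
      apply: ler_prod => k _; rewrite cl0 /=; have [ak /andP[_ ak4]] := aw u k u01.
      by apply: gl; [exact: ltnW|have := l0 k; lra].
    apply: gl => //; rewrite -natr1; have := l1 n.+1; lra.
  move=> sep'; apply: le_trans (_ : _ <= (\prod_(k < n.+2) (c * l k `^ (- D))) `^ s) _; last first.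
    apply: ge0_ler_powR; rewrite ?nnegrE //.
    by apply: prodr_ge0 => k _; rewrite mulr_ge0 ?powR_ge0 // ltW.
  have cl0 k : 0 <= c * l k `^ (- D) by rewrite mulr_ge0 ?powR_ge0 // ltW.
  rewrite (powR_prod n.+2 s cl0).
  apply: ler_prod => k _; rewrite ltW //= powRM ?powR_ge0 ?(ltW c0) //.
  by rewrite -powRrM /w mulNr (mulrC D).
move=> null; have kV0 : 0 < kap^-1 by rewrite invr_gt0.
have psiw u : 0 <= u < 1 -> window_set l (code_point f (a u)).
  by move=> u01; exists (a u) => // n; exact: aw.
have kap4 : 0 < kap / 4 by rewrite divr_gt0.
have := not_coverable s0 kV0 psiw hol (null _ kap4).
have -> : 2 * kap^-1 * (kap / 4) = 1 / 2 by field; rewrite gt_eqF.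
lra.
Qed.

End LowerBound.

(** * The exponent of convergence on digit windows *)

Section Tau2.
Context {R : realType}.
Implicit Types (s x y B alpha : R) (a : nat -> nat).

Lemma powRN_le x y s : 0 < x -> x <= y -> 0 <= s -> y `^ (- s) <= x `^ (- s).
Proof.
move=> x0 xy s0; have y0 := lt_le_trans x0 xy.
rewrite !powRN lef_pV2 ?posrE ?powR_gt0 //.
by apply: ge0_ler_powR; rewrite ?nnegrE ?(ltW x0) ?(ltW y0).
Qed.

Lemma powR_sum (I : finType) (t : I -> R) x : 0 < x ->
  \prod_i x `^ t i = x `^ (\sum_i t i).
Proof.
move=> x0; elim/big_rec2: _ => [|i u v _ ->]; first by rewrite powRr0.
by rewrite powRD // (gt_eqF x0) implybT.
Qed.

Lemma tau2_eq (m : nat) (t : 'I_m.+1 -> R) a alpha : 0 <= alpha ->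
  (forall s, alpha < s -> (\sum_(0 <= n <oo)
     ((\prod_(i < m.+1) (a (n + i)%N)%:R `^ t i) `^ (- s))%:E < +oo)%E) ->
  (forall s, 0 <= s < alpha -> ~ (\sum_(0 <= n <oo)
     ((\prod_(i < m.+1) (a (n + i)%N)%:R `^ t i) `^ (- s))%:E < +oo)%E) ->
  tau2 t a = alpha%:E.
Proof.
move=> al0 conv div; apply/eqP; rewrite eq_le; apply/andP; split.
  apply/lee_addgt0Pr => e e0; apply: ereal_inf_lbound.
  exists (alpha + e) => //; split; first by rewrite addr_ge0 // ltW.
  by apply: conv; rewrite ltrDl.
apply: le_ereal_inf_tmp => _ [s [s0 sfin] <-]; rewrite lee_fin leNgt.
by apply/negP => sal; apply: (div s); rewrite ?s0.
Qed.

Section Window.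
Context (m : nat) (t : 'I_m.+1 -> R) (l : nat -> R) (B : R) (a : nat -> nat).
Hypotheses (t0 : forall i, 0 <= t i) (l1 : forall n, 1 <= l n).
Hypotheses (lmono : forall n, l n <= l n.+1) (lB : forall n, l n.+1 <= B * l n).
Hypothesis al : forall n, l n <= (a n)%:R <= 4 * l n.
Let T := \sum_i t i.

Let l0 n : 0 < l n. Proof. exact: lt_le_trans (l1 n). Qed.

Lemma window_prod_ge n : l n `^ T <= \prod_(i < m.+1) (a (n + i)%N)%:R `^ t i.
Proof.
have lle k : l n <= l (n + k)%N.
  by elim: k => [|k IH]; rewrite ?addn0 // addnS (le_trans IH).
rewrite -powR_sum //; apply: ler_prod => i _; rewrite powR_ge0 /=.
have /andP[h _] := al (n + i); have := le_trans (lle i) h => h'.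
by apply: ge0_ler_powR; rewrite ?nnegrE ?(ltW (l0 n)).
Qed.

(** Over a window, [l] grows by at most [B ^+ m], so all its digits are at most
    [4 * B ^+ m * l n]. *)
Lemma window_prod_le n :
  \prod_(i < m.+1) (a (n + i)%N)%:R `^ t i <= (4 * B ^+ m) `^ T * l n `^ T.
Proof.
have B1 : 1 <= B.
  have := le_trans (lmono 0) (lB 0); rewrite ler_pMl //.
have lle k : l (n + k)%N <= B ^+ k * l n.
  elim: k => [|k IH]; first by rewrite addn0 expr0 mul1r.
  rewrite addnS (le_trans (lB _)) // exprS -mulrA ler_pM2l //; exact: lt_le_trans B1.
have BX k : 0 < B ^+ k by rewrite exprn_gt0 // (lt_le_trans _ B1).
have K0 : 0 < 4 * B ^+ m * l n by rewrite !mulr_gt0.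
rewrite -powRM ?(ltW (l0 n)) //; last by rewrite mulr_ge0 // ltW.
rewrite -powR_sum //; apply: ler_prod => i _; rewrite powR_ge0 /=.
have /andP[_ h] := al (n + i).
apply: ge0_ler_powR; rewrite ?nnegrE ?(ltW K0) //.
apply: le_trans h _; rewrite -mulrA ler_pM2l // (le_trans (lle _)) //.
by rewrite ler_pM2r // ler_weXn2l // -ltnS.
Qed.

End Window.

(** * Polynomial and exponential windows *)

Section PolynomialWindow.
Variable p : R.
Hypothesis p0 : 0 < p.
Let l n : R := n.+1%:R `^ p.

Lemma powR_window_ge1 n : 1 <= l n.
Proof.
have : n.+1%:R `^ 0 <= l n by apply: ler_powR; rewrite ?ler1n // ltW.
by rewrite powRr0.
Qed.

Lemma powR_window_mono n : l n <= l n.+1.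
Proof. by apply: ge0_ler_powR; rewrite ?nnegrE ?(ltW p0) // ler_nat. Qed.

Lemma powR_window_growth n : l n.+1 <= 2 `^ p * l n.
Proof.
rewrite /l -powRM //; apply: ge0_ler_powR; rewrite ?nnegrE ?(ltW p0) //.
by rewrite -natrM ler_nat; lia.
Qed.

Lemma powR_window_unbounded M : exists K, forall n, (K <= n)%N -> M <= l n.
Proof.
exists (Num.truncn (`|M| `^ p^-1)).+1 => n Kn.
apply: le_trans (ler_norm M) _.
have E : (`|M| `^ p^-1) `^ p = `|M| by rewrite -powRrM mulVf ?gt_eqF // powRr1.
rewrite -[leLHS]E; apply: ge0_ler_powR; rewrite ?nnegrE ?powR_ge0 ?(ltW p0) //.
by apply/ltW/(lt_le_trans (truncnS_gt _)); rewrite ler_nat leqW.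
Qed.

End PolynomialWindow.

Lemma exp_window_unbounded (M : R) : exists K, forall n, (K <= n)%N -> M <= 2 ^+ n.
Proof.
exists (Num.truncn M).+1 => n Kn.
apply/ltW/(lt_le_trans (truncnS_gt _)); rewrite -natrX ler_nat (leq_trans Kn) //.
exact/ltnW/ltn_expl.
Qed.

(** The exponent is chosen so that the window products have order [n] to the power [1 / alpha]; the
    series then compares with the Riemann series of exponent [s / alpha]. *)
Lemma tau2_powR_window (m : nat) (t : 'I_m.+1 -> R) a alpha : 0 < alpha ->
  (forall i, 0 <= t i) -> 0 < \sum_i t i ->
  (forall n, n.+1%:R `^ (alpha * \sum_i t i)^-1 <= (a n)%:R <=
     4 * n.+1%:R `^ (alpha * \sum_i t i)^-1) ->
  tau2 t a = alpha%:E.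
Proof.
move=> al0 t0; set T := \sum_i t i => T0.
set p := (alpha * T)^-1 => aw.
have p0 : 0 < p by rewrite invr_gt0 mulr_gt0.
have pT n : (n.+1%:R `^ p) `^ T = n.+1%:R `^ alpha^-1 :> R.
  by rewrite -powRrM /p invfM mulfVK // gt_eqF.
have n0 n : 0 < n.+1%:R `^ alpha^-1 :> R by rewrite powR_gt0.
have lo n := window_prod_ge t0 (powR_window_ge1 p0) (powR_window_mono p0) aw n.
have hi n := window_prod_le t0 (powR_window_ge1 p0) (powR_window_mono p0)
  (powR_window_growth p0) aw n.
apply: tau2_eq; first exact: ltW.
  move=> s als; have s0 : 0 <= s by rewrite ltW // (lt_trans al0).
  pose q := s / alpha - 1.
  have q0 : 0 < q by rewrite subr_gt0 ltr_pdivlMr // mul1r.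
  apply: le_lt_trans (ltry (1 + q^-1)); apply: le_trans (powR_series q0).
  apply: lee_nneseries => [n _ _|n _]; first by rewrite lee_fin powR_ge0.
  rewrite lee_fin; have := lo n; rewrite -/T pT => /(powRN_le (n0 n))/(_ s0)/le_trans; apply.
  rewrite -powRrM le_eqVlt; apply/orP; left; apply/eqP; congr (_ `^ _).
  by rewrite /q; field; rewrite gt_eqF.
move=> s /andP[s0 sal] fin.
set K := (4 * (2 `^ p) ^+ m) `^ T.
have K0 : 0 < K by rewrite powR_gt0 // mulr_gt0 // exprn_gt0 // powR_gt0.
have sa : 0 <= s / alpha <= 1.
  by rewrite divr_ge0 ?(ltW al0) //= ler_pdivrMr // mul1r ltW.
apply: (dvg_riemannR sa); apply: nnseries_is_cvg.
  by move=> n; apply/ltW/riemannR_gt0; case/andP: sa.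
apply: (@le_lt_trans _ _ ((K `^ s)%:E * \sum_(0 <= n <oo)
    ((\prod_(i < m.+1) (a (n + i)%N)%:R `^ t i) `^ (- s))%:E)%E); last first.
  by rewrite lte_mul_pinfty // lee_fin powR_ge0.
rewrite -nneseriesZl; last by move=> n _; rewrite lee_fin powR_ge0.
apply: lee_nneseries => [n _ _|n _].
  by rewrite lee_fin; apply/ltW/riemannR_gt0; case/andP: sa.
rewrite -EFinM lee_fin /riemannR -powRN.
have Q0 : 0 < \prod_(i < m.+1) (a (n + i)%N)%:R `^ t i.
  by apply: lt_le_trans (lo n); rewrite -/T pT.
have := powRN_le Q0 (hi n) s0; rewrite -/T -/K pT => h.
rewrite -ler_pdivrMl ?powR_gt0 // -powRN; apply: le_trans h.
rewrite powRM ?(ltW K0) ?(ltW (n0 n)) // -powRrM le_eqVlt; apply/orP; left; apply/eqP.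
by congr (_ * _ `^ _); rewrite mulrN mulrC.
Qed.

(** For every [s > 0] the series is dominated by a geometric one of ratio [z < 1]. *)
Lemma tau2_exp_window (m : nat) (t : 'I_m.+1 -> R) a :
  (forall i, 0 <= t i) -> 0 < \sum_i t i ->
  (forall n, (2 : R) ^+ n <= (a n)%:R <= 4 * (2 : R) ^+ n) ->
  tau2 t a = 0%:E.
Proof.
move=> t0; set T := \sum_i t i => T0 aw.
have l1 n : 1 <= 2 ^+ n :> R by rewrite exprn_ege1 // ler1n.
have lmono n : 2 ^+ n <= 2 ^+ n.+1 :> R by rewrite ler_weXn2l // ler1n.
have lo n := window_prod_ge t0 l1 lmono aw n.
apply: tau2_eq => // [s s0|s /andP[s0]]; last by rewrite ltNge s0.
pose z : R := 2 `^ (- (T * s)).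
have z0 : 0 < z by rewrite powR_gt0.
have z1 : z < 1.
  have E : 1 `^ (T * s) = 1 :> R by rewrite powR1.
  rewrite /z powRN invf_lt1 ?powR_gt0 // -[ltLHS]E.
  by rewrite gt0_ltr_powR ?mulr_gt0 ?nnegrE ?ltr1n.
apply: le_lt_trans (ltry (1 / (1 - z))).
apply: (@le_trans _ _ (\sum_(0 <= n <oo) (z ^+ n)%:E)%E).
  apply: lee_nneseries => [n _ _|n _]; first by rewrite lee_fin powR_ge0.
  rewrite lee_fin; have l0 : 0 < (2 ^+ n : R) `^ T by rewrite powR_gt0 // exprn_gt0.
  apply: le_trans (powRN_le l0 (lo n) (ltW s0)) _.
  rewrite -(powR_mulrn n (ler0n R 2)) -(powR_mulrn n (ltW z0)) -!powRrM le_eqVlt.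
  by apply/orP; left; apply/eqP; congr (_ `^ _); ring.
apply: lime_le; first by apply: is_cvg_nneseries => n _ _; rewrite lee_fin exprn_ge0 // ltW.
apply: nearW => n; rewrite sumEFin lee_fin big_mkord ler_pdivlMr ?subr_gt0 //.
have := subrX1 z n; have : 0 <= z ^+ n by rewrite exprn_ge0 // ltW.
set S := \sum_(i < n) _; lra.
Qed.

End Tau2.

(** * The two dimension bounds *)

Section Dimension.
Context {R : realType} {d : R} {f : nat -> R -> R}.
Hypotheses (hd : 1 < d) (hf : gauss_like_ifs d f).
Context {m : nat} {t : 'I_m.+1 -> R} {alpha : R}.
Hypotheses (t0 : forall i, 0 <= t i) (al0 : 0 <= alpha).

Let d0 : 0 < d. Proof. exact: lt_trans hd. Qed.

Lemma hausdorff_dim_tau2_level_le : (hausdorff_dim (tau2_level f t alpha) <= (d^-1)%:E)%E.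
Proof.
apply/lee_addgt0Pr => e e0; apply: ereal_inf_lbound.
have s0 : 0 < d^-1 + e by rewrite addr_gt0 // invr_gt0.
exists (d^-1 + e) => //; split; first exact: ltW.
apply: null_cover_hausdorff s0 (tau2_level_null hf _ t0 s0 _).
by rewrite mulrDr mulfV ?gt_eqF // ltrDl mulr_gt0.
Qed.

Lemma window_set_tau2_level (l : nat -> R) :
  (forall a, (forall n, l n <= (a n)%:R <= 4 * l n) -> tau2 t a = alpha%:E) ->
  window_set (f := f) l `<=` tau2_level f t alpha.
Proof.
move=> tl _ [a aw <-]; have a0 : positive_code a by move=> n; have [/ltnW] := aw n.
split; last first.
  exists a; split; first exact/(digits_code_point hf).
  by apply: tl => n; have [] := aw n.
rewrite (code_point_gt0 hf a0) /= (code_pointS hf a0).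
have [c c0 ex] := expands_pos hf (ltn0Sn 0).
(* Since the first digit exceeds 1, the point lies left of the image of digit 1 and so below 1. *)
apply: le_lt_trans (ifs_le_expansion hf (aw 0).1 ex _) _.
  exact/(code_point01 hf)/positive_shift.
by rewrite gtrBl.
Qed.

Lemma hausdorff_dim_tau2_level_ge : t ord0 != 0 ->
  ((d^-1)%:E <= hausdorff_dim (tau2_level f t alpha))%E.
Proof.
move=> t00; have T0 : 0 < \sum_i t i.
  rewrite (bigD1 ord0) //= ltr_pwDl ?sumr_ge0 //.
  by rewrite lt_neqAle eq_sym t00 t0.
apply: le_ereal_inf_tmp => _ [s [s0 Es] <-]; rewrite lee_fin leNgt; apply/negP => sd.
have {sd} sd : s * d < 1 by rewrite -ltr_pdivlMr // div1r.
have Enull := hausdorff_measure0_coverable Es.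
(* For [alpha = 0] no power of [n] grows fast enough, so the windows are exponential. *)
have [alE|aln] := eqVneq alpha 0.
  apply: (window_set_not_null hf (l := fun n => 2 ^+ n) (B := 2) _ _ _ s0 sd d0).
  - by move=> n; rewrite exprn_ege1 // ler1n.
  - by move=> n; rewrite exprS.
  - exact: exp_window_unbounded.
  apply: null_cover_sub Enull; apply: window_set_tau2_level => a aw.
  by rewrite alE; exact: tau2_exp_window.
have al1 : 0 < alpha by rewrite lt_neqAle eq_sym aln.
have p0 : 0 < (alpha * \sum_i t i)^-1 by rewrite invr_gt0 mulr_gt0.
apply: (window_set_not_null hf (powR_window_ge1 p0) (powR_window_growth p0)
  (powR_window_unbounded p0) s0 sd d0).
apply: null_cover_sub Enull; apply: window_set_tau2_level => a aw.
exact: tau2_powR_window.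
Qed.

End Dimension.

Unset Implicit Arguments.

Theorem theorem1p7 (R : realType) (d : R) (hd : 1 < d)
    (f : nat -> R -> R) (hf : gauss_like_ifs d f)
    (m : nat) (hm : (1 <= m)%N) (t : 'I_m.+1 -> R)
    (ht : forall i : 'I_m.+1, 0 <= t i)
    (ht0 : t ord0 <> 0)
    (hti : exists i : 'I_m.+1, (1 <= i)%N /\ t i <> 0)
    (alpha : R) (halpha : 0 <= alpha) :
  hausdorff_dim (tau2_level f t alpha) = (d^-1)%:E.
Proof.
apply/eqP; rewrite eq_le; apply/andP; split.
  exact: hausdorff_dim_tau2_level_le.
by apply: hausdorff_dim_tau2_level_ge => //; exact/eqP.
Qed.
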